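(* Let $M_t=\{(x,u(x,t)):x\in\mathbb{R}^n\}\subset\mathbb{R}^{n+1}$, $t\in(0,+\infty)$, be any smooth convex proper entire graph solution of mean curvature flow. Then $M_t$ satisfies Hamilton's Harnack differential inequality: for every tangent vector field $V$ on $M_t$ and every $t>0$, $$\frac{\partial H}{\partial t}+2\langle\nabla H,V\rangle+h(V,V)+\frac{H}{2t}\ge0.$$
   Context: Mean curvature flow means that the hypersurfaces $M_t=F(M^n,t)$ are given by immersions $F(\cdot,t)$ with $\frac{\partial}{\partial t}F(p,t)=H(p,t)\,\nu(p,t)$, where $\nu$ is the inward (here: upward) pointing unit normal and $H$ is the mean curvature with respect to $\nu$, with signs such that $H\ge 0$ on convex graphs; $\partial H/\partial t$ is taken at fixed $p\in M^n$. Here $h$ is the second fundamental form, which in graph coordinates is $h_{ij}=D_{ij}u/\sqrt{1+|Du|^2}$, $H$ is its trace with respect to the induced metric, and $\nabla$ is the gradient on $M_t$. A proper entire graph is the graph of a function $u(\cdot,t)$ on $\mathbb{R}^n$ with $u(x,t)\to+\infty$ as $|x|\to+\infty$; convex means that $u(\cdot,t)$ is convex. *)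

(* Defs.v *)
From HB Require Import structures.
From mathcomp Require Import all_boot all_order all_algebra.
From mathcomp Require Import all_classical all_reals all_analysis.

Set Implicit Arguments.
Unset Strict Implicit.
Unset Printing Implicit Defensive.

Import Order.TTheory GRing.Theory Num.Theory.
Import numFieldNormedType.Exports.

Local Open Scope classical_set_scope.
Local Open Scope ring_scope.

(* C^infty on an open set U of a finite-dimensional space: all iterated
   directional derivatives (directions listed in s) are differentiable on U. *)
Definition smooth_on (R : realType) (V W : normedModType R)
    (U : set V) (f : V -> W) : Prop :=
  forall (s : seq V) (x : V), U x ->
    differentiable (foldr (fun (v : V) (g : V -> W) => 'D_v g) f s) x.

Section Manifold.
Variables (R : realType) (n : nat) (M : Type).

(* A chart is a local parametrization: an open set of R^n together with a map
   into M, whose values outside the open set are irrelevant. *)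
Definition chart : Type := (set 'rV[R]_n * ('rV[R]_n -> M))%type.

Definition chart_overlap (c d : chart) : set 'rV[R]_n :=
  [set y | c.1 y /\ (d.2 @` d.1) (c.2 y)].

(* The topology of M is the one generated by the images under the charts of
   the open subsets of their domains; the last two fields say that it is
   Hausdorff and second countable. *)
Record smooth_manifold (A : set chart) : Prop := SmoothManifold {
  chart_open : forall c, A c -> open c.1 ;
  chart_inj : forall c, A c -> set_inj c.1 c.2 ;
  chart_cover : forall p : M, exists2 c, A c & (c.2 @` c.1) p ;
  chart_overlap_open : forall c d, A c -> A d -> open (chart_overlap c d) ;
  chart_transition : forall c d, A c -> A d ->
    exists2 tau : 'rV[R]_n -> 'rV[R]_n,
      smooth_on (chart_overlap c d) tau &
      forall y, chart_overlap c d y -> d.1 (tau y) /\ d.2 (tau y) = c.2 y ;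
  manifold_hausdorff : forall p q : M, p <> q ->
    exists c d (O1 O2 : set 'rV[R]_n),
      [/\ A c /\ A d, open O1 /\ O1 `<=` c.1, open O2 /\ O2 `<=` d.1,
          (c.2 @` O1) p /\ (d.2 @` O2) q &
          (c.2 @` O1) `&` (d.2 @` O2) = set0] ;
  manifold_second_countable : exists B : set chart,
    [/\ countable B, B `<=` A &
        forall p : M, exists2 c, B c & (c.2 @` c.1) p] }.

End Manifold.

Section GraphGeometry.
Variables (R : realType) (n : nat).
Implicit Types (f phi : 'rV[R]_n -> R) (x v : 'rV[R]_n).
Implicit Types (X Y : 'rV[R]_(n + 1)).

(* The library norm on row vectors is the sup norm, so the Euclidean structure
   is made explicit. *)
Definition dot (m : nat) (v w : 'rV[R]_m) : R := \sum_(i < m) v 0 i * w 0 i.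

Definition enorm (m : nat) (v : 'rV[R]_m) : R := Num.sqrt (dot v v).

Definition partial f (i : 'I_n) : 'rV[R]_n -> R := 'D_(delta_mx 0 i) f.

Definition Du f x : 'rV[R]_n := \row_i partial f i x.

Definition D2u f x : 'M[R]_n := \matrix_(i, j) partial (partial f j) i x.

Definition graph_pt f x : 'rV[R]_(n + 1) := row_mx x (f x)%:M.

Definition graph f : set 'rV[R]_(n + 1) := range (graph_pt f).

Definition area_element f x : R := Num.sqrt (1 + dot (Du f x) (Du f x)).

Definition upward_normal f x : 'rV[R]_(n + 1) :=
  (area_element f x)^-1 *: row_mx (- Du f x) 1%:M.

(* The differential of graph_pt f at x in the direction v. *)
Definition graph_tangent f x v : 'rV[R]_(n + 1) :=
  row_mx v (dot (Du f x) v)%:M.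

Definition tangent_at f x X : Prop := exists v, X = graph_tangent f x v.

Definition tangent_field f (V : 'rV[R]_(n + 1) -> 'rV[R]_(n + 1)) : Prop :=
  forall x, tangent_at f x (V (graph_pt f x)).

(* g_ij = delta_ij + D_i f D_j f *)
Definition metric_mx f x : 'M[R]_n := 1%:M + (Du f x)^T *m Du f x.

Definition sff_mx f x : 'M[R]_n := (area_element f x)^-1 *: D2u f x.

(* lsubmx recovers v from graph_tangent f x v. *)
Definition sff f x X Y : R :=
  (lsubmx X *m sff_mx f x *m (lsubmx Y)^T) 0 0.

Definition mean_curvature f x : R := \tr (invmx (metric_mx f x) *m sff_mx f x).

(* Gradient with respect to the induced metric of a function phi on the graph,
   given in graph coordinates: g^ij D_j phi in the basis of tangent vectors
   graph_tangent f x e_i. *)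
Definition graph_grad f phi x : 'rV[R]_(n + 1) :=
  graph_tangent f x (Du phi x *m invmx (metric_mx f x)).

Definition proper_entire f : Prop :=
  forall a : R, exists r : R, forall x, r < enorm x -> a < f x.

End GraphGeometry.

Section GraphFlow.
Variables (R : realType) (n : nat) (M : Type).
Variables (A : set (chart R n M)) (F : M -> R -> 'rV[R]_(n + 1)).
Variable u : 'rV[R]_n -> R -> R.

Definition base_pt (p : M) (t : R) : 'rV[R]_n := lsubmx (F p t).

Definition curvature_at (p : M) (t : R) : R :=
  mean_curvature (u^~ t) (base_pt p t).

Definition smooth_graph_function : Prop :=
  smooth_on [set z : 'rV[R]_n * R | 0 < z.2] (fun z : 'rV[R]_n * R => u z.1 z.2).

(* F is a smooth family of immersions of M, t > 0, moving by mean curvature,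
   with F(M, t) the graph of u(., t). *)
Record graph_mean_curvature_flow : Prop := GraphMeanCurvatureFlow {
  flow_smooth : forall c, A c ->
    smooth_on [set z : 'rV[R]_n * R | c.1 z.1 /\ 0 < z.2]
              (fun z : 'rV[R]_n * R => F (c.2 z.1) z.2) ;
  flow_immersion : forall c, A c -> forall t : R, 0 < t -> forall y, c.1 y ->
    forall v : 'rV[R]_n, 'D_v (fun z : 'rV[R]_n => F (c.2 z) t) y = 0 -> v = 0 ;
  flow_graph : forall t : R, 0 < t -> range (F^~ t) = graph (u^~ t) ;
  flow_eq : forall (p : M) (t : R), 0 < t ->
    is_derive t (1 : R) (F p)
      (curvature_at p t *: upward_normal (u^~ t) (base_pt p t)) }.

End GraphFlow.

(* Main.v *)
Require Import Defs.
From HB Require Import structures.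
From mathcomp Require Import all_boot all_order all_algebra.
From mathcomp Require Import all_classical all_reals all_analysis.
From mathcomp Require Import ring lra.

Set Implicit Arguments.
Unset Strict Implicit.
Unset Printing Implicit Defensive.

Import Order.TTheory GRing.Theory Num.Theory.
Import numFieldNormedType.Exports.

Local Open Scope classical_set_scope.
Local Open Scope ring_scope.

(** In graph coordinates the flow is the scalar equation
      u_t = tr (a(Du) D2u),   a(p) = I - p^T p / (1 + |p|^2),
    and, for the vector field V that lifts v, the left-hand side of the
    inequality times the area element is
      u_tt + 2 <D u_t, eta> + D2u(eta, eta) + u_t / (2 t)
    with eta = v - u_t / (1 + |Du|^2) Du. Up to the factor 4 t, this is the
    Hessian of (x, s) |-> u(x, s^2) at s = sqrt t in the direction
    (2 s eta, 1). The Harnack inequality is therefore the statement that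
    u(x, s^2) is jointly convex in (x, s), and it is in this form, which asks
    for two derivatives instead of the four of Hamilton's tensor computation,
    that it is proved.

    Joint convexity follows from the midpoint inequality
      u((x0 + x1) / 2, t) <= u(x0, a^2 t) / 2 + u(x1, b^2 t) / 2,   a + b = 2,
    [cgf_midpoint], by a maximum principle in the variables (x0, x1, t). Where
    the difference of the two sides is maximal, the three gradients coincide,
    and moving x0 and x1 in the directions a xi and b xi shows that the Hessian
    on the left is at most the sum of those on the right with weights a^2/2 and
    b^2/2; the trace against a(p) says the same of the time derivatives, which
    contradicts the growth of the difference once it is made strict
    [touching_speeds].

    The domain being unbounded, with no bound on the curvature or on the growth
    of u, a maximum has to be produced. The left-hand side is replaced by
    u(k x, k^2 t) with k < 1. This is still a subsolution: the gradient becomes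
    k Du, and a(k p) >= a(p) as quadratic forms, while D2u >= 0
    [mc_operator_scale]. Moreover a shrinking sphere placed above the initial
    graph bounds u(k x, k^2 t) by k u(x, 0) + C on bounded time intervals
    [cgf_barrier, cgf_growth], whereas the right-hand side is at least the mean
    of the initial values, since u increases in time. As u(x, 0) tends to
    infinity, the difference tends to minus infinity [cgf_comparison]. Then k
    tends to 1.

    All this needs a flow that is regular up to its initial time, so it is
    applied to u(x, s + t) with s > 0 [delayed_flow]; the inequality comes out
    with t - s instead of t in the last term, and s tends to 0
    [harnack_quadratic]. *)

(** * Derivatives of functions of one variable *)

Section OneVariable.
Variable R : realType.
Implicit Types (f g : R -> R) (s t d h k : R).

(** A predicate that does not take part in type class resolution, unlike
    [is_derive], so that the rules below can be chained by [apply]. *)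
Definition has_deriv f t d : Prop := is_derive t (1 : R) f d.

Lemma has_deriv_eq f t d1 d2 : has_deriv f t d1 -> d1 = d2 -> has_deriv f t d2.
Proof. by move=> ? <-. Qed.

Lemma is_derive_curve (V W : normedModType R) (f : V -> W) (c : R -> V)
    (h : R) (v : V) :
  differentiable f (c h) -> is_derive h 1 c v ->
  is_derive h 1 (f \o c) ('D_v f (c h)).
Proof.
move=> df [dc cv].
have dc' : differentiable c h by apply/derivable1_diffP.
apply: DeriveDef.
  by apply: diff_derivable; exact: differentiable_comp.
rewrite deriveE; last exact: differentiable_comp.
by rewrite diff_comp //= -(deriveE _ dc') cv deriveE.
Qed.

Lemma is_derive_affine (V : normedModType R) (x v : V) h :
  is_derive h (1 : R) (fun h => x + h *: v) v.
Proof.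
have vd : is_diff h (fun h : R => h *: v) (fun h : R => h *: v).
  exact: is_diff_scalel.
have dv : is_derive h (1 : R) (fun h : R => h *: v) v.
  apply: DeriveDef; first exact: diff_derivable.
  by rewrite deriveE // diff_val scale1r.
by rewrite -[X in is_derive _ _ _ X]add0r; exact: is_deriveD.
Qed.

Lemma has_deriv_gt0_incr f t d : has_deriv f t d -> 0 < d ->
  exists2 e, 0 < e & forall h, 0 < h < e -> f (t - h) < f t < f (t + h).
Proof.
move=> [df fd] d0.
have := df; rewrite /derivable => /cvg_ex [l fl].
have ld : l = d by rewrite -fd /derive; apply/esym/cvg_lim.
rewrite {}ld in fl.
move/cvgrPdist_lt/(_ _ d0): fl; rewrite near_withinE /= nearE /=.
move=> /nbhs_ballP[e e0 He]; exists e => // k /andP[k0 ke].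
have {}He h : h != 0 -> `|h| < e -> 0 < h^-1 * (f (t + h) - f t).
  move=> h0 he; have := He h _ h0; rewrite /ball /= sub0r normrN => /(_ he).
  rewrite [h *: 1](mulr1) (addrC h t) => H.
  have := ler_norm (d - h^-1 *: (f (t + h) - f t)).
  by move=> /le_lt_trans/(_ H); rewrite ltrBlDr ltrDl.
have := He k; rewrite gt_eqF // gtr0_norm // => /(_ isT ke).
rewrite pmulr_rgt0 ?invr_gt0 // subr_gt0 => ->; rewrite andbT.
have := He (- k); rewrite oppr_eq0 gt_eqF // normrN gtr0_norm // => /(_ isT ke).
by rewrite invrN mulNr oppr_gt0 pmulr_rlt0 ?invr_gt0 // subr_lt0.
Qed.

Lemma exists_lt2 (a b : R) : 0 < a -> 0 < b -> exists h, [/\ 0 < h, h < a & h < b].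
Proof.
move=> a0 b0; exists (Num.min a b / 2).
have : 0 < Num.min a b by rewrite lt_min a0.
have : Num.min a b <= a by rewrite ge_min lexx.
have : Num.min a b <= b by rewrite ge_min lexx orbT.
by move=> *; split; lra.
Qed.

(** The maximum may be attained at the final time, where only the left
    difference quotients are controlled. *)
Lemma has_deriv_left_max f t d : 0 < t -> has_deriv f t d ->
  (forall s, 0 <= s <= t -> f s <= f t) -> 0 <= d.
Proof.
move=> t0 df fmax; rewrite leNgt; apply/negP => d0.
have dNf : has_deriv (- f) t (- d) by exact: is_deriveN.
have [|e e0 He] := has_deriv_gt0_incr dNf; first by rewrite oppr_gt0.
have [h [h0 ht he]] := exists_lt2 t0 e0.
have /andP[+ _] := He h (introT andP (conj h0 he)).
rewrite !fctE ltrN2 ltNge fmax //; lra.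
Qed.

Lemma has_deriv_local_max f t d : has_deriv f t d ->
  (\forall s \near t, f s <= f t) -> d = 0.
Proof.
move=> df /nbhs_ballP [e e0 He].
have {}He h : `|h| < e -> f (t + h) <= f t.
  by move=> he; apply: He; rewrite /ball /= opprD addNKr normrN.
case: (ltgtP d 0) => // d0.
  - have dNf : has_deriv (- f) t (- d) by exact: is_deriveN.
    have [|k k0 Hk] := has_deriv_gt0_incr dNf; first by rewrite oppr_gt0.
    have [h [h0 he hk]] := exists_lt2 e0 k0.
    have /andP[+ _] := Hk h (introT andP (conj h0 hk)).
    by rewrite !fctE ltrN2 ltNge He // normrN gtr0_norm.
  - have [k k0 Hk] := has_deriv_gt0_incr df d0.
    have [h [h0 he hk]] := exists_lt2 e0 k0.
    have /andP[_] := Hk h (introT andP (conj h0 hk)).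
    by rewrite ltNge He // gtr0_norm.
Qed.

Lemma second_order_max g (g' : R -> R) (g2 : R) :
  (\forall h \near (0 : R), has_deriv g h (g' h)) ->
  has_deriv g' (0 : R) g2 ->
  (\forall h \near (0 : R), g h <= g 0) -> g2 <= 0.
Proof.
move=> dg dg' gmax.
have g'0 : g' 0 = 0 by apply: has_deriv_local_max gmax; exact: nbhs_singleton dg.
have : \forall h \near (0 : R), has_deriv g h (g' h) /\ g h <= g 0.
  exact: filterI.
move=> /nbhs_ballP [e e0 He].
have {dg gmax}He h : `|h| < e -> has_deriv g h (g' h) /\ g h <= g 0.
  by move=> he; apply: He; rewrite /ball /= sub0r normrN.
rewrite leNgt; apply/negP => g20.
have [k k0 Hk] := has_deriv_gt0_incr dg' g20.
have [h [h0 he hk]] := exists_lt2 e0 k0.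
have gd x : 0 <= x <= h -> has_deriv g x (g' x).
  move=> /andP[x0 xh]; have [|//] := He x.
  by rewrite ger0_norm // (le_lt_trans xh).
have gc : {within `[0, h], continuous g}.
  apply: derivable_within_continuous => x; rewrite in_itv /= => /gd.
  by case.
have gd' x : x \in `]0, h[%R -> has_deriv g x (g' x).
  by rewrite in_itv /= => /andP[x0 xh]; apply: gd; rewrite !ltW.
have [c] := MVT h0 gd' gc.
rewrite in_itv /= => /andP[c0 ch] gh.
have /andP[_] := Hk c (introT andP (conj c0 (lt_trans ch hk))).
rewrite add0r g'0 => g'c.
have : 0 < g h - g 0 by rewrite gh mulr_gt0 // subr_gt0.
by rewrite subr_gt0 ltNge (He h _).2 // gtr0_norm.
Qed.

Lemma has_derivD f g t d1 d2 : has_deriv f t d1 -> has_deriv g t d2 ->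
  has_deriv (fun s => f s + g s) t (d1 + d2).
Proof. exact: is_deriveD. Qed.

Lemma has_derivN f t d1 : has_deriv f t d1 ->
  has_deriv (fun s => - f s) t (- d1).
Proof. exact: is_deriveN. Qed.

Lemma has_derivM f g t d1 d2 : has_deriv f t d1 -> has_deriv g t d2 ->
  has_deriv (fun s => f s * g s) t (f t * d2 + g t * d1).
Proof. exact: is_deriveM. Qed.

Lemma has_derivZ f t k d1 : has_deriv f t d1 ->
  has_deriv (fun s => k * f s) t (k * d1).
Proof. exact: is_deriveZ. Qed.

Lemma has_deriv_cst t k : has_deriv (fun=> k) t 0.
Proof. exact: is_derive_cst. Qed.

Lemma has_deriv_id t : has_deriv (fun s : R => s : R) t 1.
Proof. exact: (@is_derive_id R R t 1). Qed.

Lemma has_deriv_rescale f t k d1 : has_deriv f (k * t) d1 ->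
  has_deriv (fun s => f (k * s)) t (k * d1).
Proof.
move=> fd; have kd : has_deriv (fun s => k * s) t k.
  by apply: has_deriv_eq (mulr1 k); apply: has_derivZ; exact: has_deriv_id.
have df : differentiable f (k * t) by apply/derivable1_diffP; case: fd.
have := @is_derive_curve _ _ f (fun s => k * s) t k df kd.
suff -> : 'D_k f (k * t) = k * d1 by [].
case: fd => _ <-; rewrite !deriveE // -[X in 'd f _ X]mulr1.
exact: linearZ.
Qed.

Lemma le_continuous_left f t d e : 0 < e -> {for t, continuous f} ->
  (forall s, t - e < s < t -> f s <= d) -> f t <= d.
Proof.
move=> e0 cf fd; rewrite leNgt; apply/negP => dft.
have : 0 < f t - d by rewrite subr_gt0.
move/(cvgrPdist_lt _ _).1 : cf => /[apply] /nbhs_ballP[k k0 Hk].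
have [h [h0 he hk]] := exists_lt2 e0 k0.
have := Hk (t - h); rewrite /ball /= opprB addrC subrK gtr0_norm // => /(_ hk).
have := fd (t - h); rewrite ltrD2l ltrN2 he gtrDl oppr_lt0 h0 => /(_ isT) fth.
have := ler_norm (f t - f (t - h)) => /le_lt_trans/[apply]; lra.
Qed.

End OneVariable.

(** * Quadratic forms and the mean curvature operator *)

Section QuadraticForms.
Variables (R : realType) (n : nat).
Implicit Types (v w p : 'rV[R]_n) (A B : 'M[R]_n) (k : R).

Definition quad A v : R := (v *m A *m v^T) 0 0.

Lemma dotE v w : dot v w = (v *m w^T) 0 0.
Proof. by rewrite /dot mxE; apply: eq_bigr => i _; rewrite mxE. Qed.

Lemma dotC v w : dot v w = dot w v.
Proof. by apply: eq_bigr => i _; rewrite mulrC. Qed.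

Lemma dotDr p v w : dot p (v + w) = dot p v + dot p w.
Proof. by rewrite !dotE linearD mulmxDr mxE. Qed.

Lemma dotZr k v w : dot v (k *: w) = k * dot v w.
Proof. by rewrite !dotE linearZ /= -scalemxAr mxE. Qed.

Lemma dotNr v w : dot v (- w) = - dot v w.
Proof. by rewrite -scaleN1r dotZr mulN1r. Qed.

Lemma dotDl p v w : dot (v + w) p = dot v p + dot w p.
Proof. by rewrite dotC dotDr !(dotC p). Qed.

Lemma dotZl k v w : dot (k *: v) w = k * dot v w.
Proof. by rewrite dotC dotZr dotC. Qed.

Lemma dotNl v w : dot (- v) w = - dot v w.
Proof. by rewrite dotC dotNr dotC. Qed.

Lemma dotvv_ge0 v : 0 <= dot v v.
Proof. by apply: sumr_ge0 => i _; rewrite -expr2 sqr_ge0. Qed.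

Lemma dot_delta v i : dot v (delta_mx 0 i) = v 0 i.
Proof.
rewrite /dot (bigD1 i) //= mxE !eqxx mulr1 big1 ?addr0 // => j ji.
by rewrite mxE (negPf ji) andbF mulr0.
Qed.

Lemma add1_dotvv_gt0 v : 0 < 1 + dot v v.
Proof. by rewrite ltr_wpDr ?dotvv_ge0. Qed.

Lemma quadDl A B v : quad (A + B) v = quad A v + quad B v.
Proof. by rewrite /quad mulmxDr mulmxDl mxE. Qed.

Lemma quadZl k A v : quad (k *: A) v = k * quad A v.
Proof. by rewrite /quad -scalemxAr -scalemxAl mxE. Qed.

Lemma quadNl A v : quad (- A) v = - quad A v.
Proof. by rewrite -scaleN1r quadZl mulN1r. Qed.

Lemma quadZr k A v : quad A (k *: v) = k ^+ 2 * quad A v.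
Proof. by rewrite /quad linearZ /= -!scalemxAl -scalemxAr !mxE mulrA. Qed.

Lemma quad1 v : quad 1%:M v = dot v v.
Proof. by rewrite /quad mulmx1 dotE. Qed.

Lemma quad_tens p v : quad (p^T *m p) v = dot p v ^+ 2.
Proof.
rewrite /quad mulmxA -mulmxA mxE big_ord1 -!dotE expr2.
by rewrite [in LHS]dotC dotE.
Qed.

Lemma quadE A v : quad A v = \sum_i \sum_j v 0 i * v 0 j * A i j.
Proof.
rewrite /quad mxE exchange_big /=; apply: eq_bigr => j _.
rewrite mxE mulr_suml; apply: eq_bigr => i _.
by rewrite mxE mulrAC.
Qed.

Lemma bilin_delta A i j :
  ((delta_mx 0 i : 'rV[R]_n) *m A *m (delta_mx 0 j : 'rV[R]_n)^T) 0 0 = A i j.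
Proof. by rewrite -rowE trmx_delta -colE !mxE. Qed.

Lemma quadDr A v w : quad A (v + w) =
  quad A v + quad A w + ((v *m A *m w^T) 0 0 + (w *m A *m v^T) 0 0).
Proof.
have mxED (X Y : 'M[R]_1) : (X + Y) 0 0 = X 0 0 + Y 0 0 by rewrite mxE.
by rewrite /quad [(v + w)^T]linearD /= !mulmxDl !mulmxDr !mxED; ring.
Qed.

Lemma quad_subZ A v w k : A^T = A ->
  quad A (v - k *: w) = quad A v - 2 * k * dot (w *m A) v + k ^+ 2 * dot (w *m A) w.
Proof.
move=> AT; have E1 : (v *m A *m (- k *: w)^T) 0 0 = - k * dot (w *m A) v.
  rewrite [(- k *: w)^T]linearZ /= -scalemxAr [LHS]mxE dotC dotE.
  by rewrite trmx_mul AT mulmxA.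
have E2 : ((- k *: w) *m A *m v^T) 0 0 = - k * dot (w *m A) v.
  by rewrite -!scalemxAl [LHS]mxE dotE.
have E3 : quad A w = dot (w *m A) w by rewrite dotE.
rewrite -scaleNr quadDr E1 E2 quadZr E3; ring.
Qed.

Lemma quad_2delta A (a b : R) i j :
  quad A (a *: delta_mx 0 i - b *: delta_mx 0 j) =
  a ^+ 2 * A i i + b ^+ 2 * A j j - a * b * (A i j + A j i).
Proof.
have bilZ k l v w : ((k *: v) *m A *m (l *: w)^T) 0 0 =
    k * l * (v *m A *m w^T) 0 0.
  rewrite [(l *: w)^T]linearZ /= -!scalemxAl -scalemxAr.
  by rewrite [LHS]mxE [X in k * X]mxE mulrA.
rewrite -scaleNr quadDr /quad !bilZ !bilin_delta; ring.
Qed.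

(** Summing over i, j the values of the form on p_j e_i - p_i e_j, each of
    which is nonnegative, gives 2 (|p|^2 tr A - A(p, p)). *)
Lemma psd_quad_le_trace A p : (forall v, 0 <= quad A v) ->
  quad A p <= dot p p * \tr A.
Proof.
move=> A0.
have : 0 <= \sum_i \sum_j quad A (p 0 j *: delta_mx 0 i - p 0 i *: delta_mx 0 j).
  by apply: sumr_ge0 => i _; apply: sumr_ge0.
under eq_bigr do under eq_bigr do rewrite quad_2delta mulrDr opprD addrA.
under eq_bigr do rewrite !big_split /= !sumrN.
rewrite !big_split /= !sumrN.
have E1 : \sum_i \sum_j p 0 j ^+ 2 * A i i = dot p p * \tr A.
  rewrite exchange_big /= /dot mulr_suml; apply: eq_bigr => j _.
  by rewrite /mxtrace mulr_sumr; apply: eq_bigr => i _; rewrite expr2.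
have E2 : \sum_i \sum_j p 0 i ^+ 2 * A j j = dot p p * \tr A.
  rewrite -E1 exchange_big /=; apply: eq_bigr => j _; exact: eq_bigr.
have E3 : \sum_i \sum_j p 0 j * p 0 i * A i j = quad A p.
  by rewrite quadE; apply: eq_bigr => i _; apply: eq_bigr => j _; rewrite (mulrC (p 0 j)).
have E4 : \sum_i \sum_j p 0 j * p 0 i * A j i = quad A p.
  by rewrite quadE exchange_big /=.
rewrite E1 E2 E3 E4; lra.
Qed.

(** tr ((I - p^T p / (1 + |p|^2)) A): the speed u_t of a graph with
    gradient p and Hessian A. *)
Definition mc_operator p A : R := \tr A - quad A p / (1 + dot p p).

Lemma mc_operatorD p A B :
  mc_operator p (A + B) = mc_operator p A + mc_operator p B.
Proof. by rewrite /mc_operator linearD /= quadDl; lra. Qed.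

Lemma mc_operatorZ p k A : mc_operator p (k *: A) = k * mc_operator p A.
Proof. by rewrite /mc_operator linearZ /= quadZl; lra. Qed.

Lemma mc_operatorN p A : mc_operator p (- A) = - mc_operator p A.
Proof. by rewrite -scaleN1r mc_operatorZ mulN1r. Qed.

Lemma mc_operator_ge0 p A : (forall v, 0 <= quad A v) -> 0 <= mc_operator p A.
Proof.
move=> A0; rewrite /mc_operator subr_ge0 ler_pdivrMr ?add1_dotvv_gt0 //.
have trA0 : 0 <= \tr A.
  apply: sumr_ge0 => i _; have := A0 (delta_mx 0 i).
  by rewrite /quad bilin_delta.
have := psd_quad_le_trace p A0; lra.
Qed.

(** Shallower convex graphs with the same Hessian move faster, because
    a(k p) >= a(p); this is what makes u(k x, k^2 t) a subsolution. *)
Lemma mc_operator_scale k p A : (forall v, 0 <= quad A v) -> 0 <= k <= 1 ->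
  mc_operator p A <= mc_operator (k *: p) A.
Proof.
move=> A0 /andP[k0 k1]; rewrite /mc_operator lerD2l lerN2 quadZr.
rewrite ler_pdivrMr ?add1_dotvv_gt0 // [leRHS]mulrAC ler_pdivlMr ?add1_dotvv_gt0 //.
rewrite dotZl dotZr mulrA -expr2.
have k2 : k ^+ 2 <= 1 by rewrite expr_le1.
have := ler_wpM2r (A0 p) k2; nra.
Qed.

End QuadraticForms.

(** * Parabolic maximum principle *)

Section MaximumPrinciple.
Variable R : realType.

(** If f were positive somewhere, compactness of K would give a maximum over the
    slab, at a positive time. It would be a maximum in space at its time and in
    time over its own past, which is what the last hypothesis excludes. *)
Lemma parabolic_maximum (X : topologicalType) (K : set X) (f : X * R -> R)
    (T : R) :
  compact K ->
  (forall x t, K x -> 0 <= t <= T -> {for (x, t), continuous f}) ->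
  (forall x t, ~ K x -> 0 <= t <= T -> f (x, t) <= 0) ->
  (forall x, f (x, 0) <= 0) ->
  (forall x t, 0 < t <= T -> (forall y, f (y, t) <= f (x, t)) ->
    (forall s, 0 <= s <= t -> f (x, s) <= f (x, t)) -> False) ->
  forall x t, 0 <= t <= T -> f (x, t) <= 0.
Proof.
move=> cK cf fout f0 fmax x t tT; rewrite leNgt; apply/negP => fxt.
pose A := K `*` `[0, T].
have Kx : K x by apply: contrapT => /fout/(_ tT); rewrite leNgt fxt.
have Axt : A (x, t) by split => //=; rewrite in_itv.
have cA : compact A by apply: compact_setX => //; exact: segment_compact.
have cfA : {within A, continuous f}.
  apply: continuous_in_subspaceT => -[y s]; rewrite inE => -[/= Ky].
  by rewrite in_itv /= => sT; exact: cf.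
have [[x0 t0]] := compact_EVT_max (ex_intro A _ Axt) cA cfA.
rewrite inE => -[/= Kx0]; rewrite in_itv /= => t0T max0.
have {}max0 y s : K y -> 0 <= s <= T -> f (y, s) <= f (x0, t0).
  by move=> Ky sT; apply: max0; rewrite inE; split => //=; rewrite in_itv.
have f00 : 0 < f (x0, t0) by apply: lt_le_trans fxt _; exact: max0.
have t00 : 0 < t0.
  rewrite lt_neqAle; case/andP: t0T => -> _; rewrite andbT.
  by apply/eqP => t00; move: f00; rewrite -t00 ltNge f0.
case/andP: (t0T) => _ t0T'; apply: (fmax x0 t0) => [|y|s /andP[s0 st0]].
- by rewrite t00.
- case: (pselect (K y)) => [Ky|/fout/(_ t0T) fy]; first exact: max0.
  by rewrite (le_trans fy) // ltW.
- by apply: max0 => //; rewrite s0 (le_trans st0).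
Qed.

Lemma rV_ball_compact n (r : R) : compact [set x : 'rV[R]_n | `|x| <= r].
Proof.
apply: bounded_closed_compact.
  exists r; split; first exact: num_real.
  by move=> M rM x /= /le_trans; apply; exact: ltW.
have -> : [set x : 'rV[R]_n | `|x| <= r] = (fun x => `|x|) @^-1` [set y | y <= r] by [].
by apply: preimage_closed => [x _|]; [exact: norm_continuous | exact: closed_le].
Qed.

Lemma norm_le_enorm n (x : 'rV[R]_n) : `|x| <= enorm x.
Proof.
rewrite [leLHS]/Num.norm /= mx_normrE; apply: bigmax_le => [|[i j] _] /=.
  exact: sqrtr_ge0.
rewrite (ord1 i) -sqrtr_sqr ler_sqrt ?dotvv_ge0 // /dot (bigD1 j) //= expr2.
by rewrite lerDl; apply: sumr_ge0 => k _; rewrite -expr2 sqr_ge0.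
Qed.

End MaximumPrinciple.

(** * Comparison for convex proper graphs *)

Section ConvexGraphFlow.
Variables (R : realType) (n : nat).
Implicit Types (w : 'rV[R]_n -> R -> R) (x y z v : 'rV[R]_n) (t T r : R).

(** A graph flow regular up to time 0, reduced to what the comparison
    argument uses: derivatives along lines and the scalar equation. *)
Record convex_graph_flow w : Prop := ConvexGraphFlow {
  cgf_continuous : forall x t, 0 <= t ->
    {for (x, t), continuous (fun z : 'rV[R]_n * R => w z.1 z.2)} ;
  cgf_gradient : forall x v t h, 0 <= t ->
    has_deriv (fun h : R => w (x + h *: v) t) h (dot (Du (w^~ t) (x + h *: v)) v) ;
  cgf_hessian : forall x v t, 0 <= t ->
    has_deriv (fun h : R => dot (Du (w^~ t) (x + h *: v)) v) (0 : R)
      (quad (D2u (w^~ t) x) v) ;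
  cgf_equation : forall x t, 0 <= t ->
    has_deriv (w x) t (mc_operator (Du (w^~ t) x) (D2u (w^~ t) x)) ;
  cgf_convex : forall x y t k, 0 <= t -> 0 <= k <= 1 ->
    w (k *: x + (1 - k) *: y) t <= k * w x t + (1 - k) * w y t ;
  cgf_proper : forall a, exists r, forall x, r < `|x| -> a < w x 0 }.

Variables (w : 'rV[R]_n -> R -> R) (wF : convex_graph_flow w).
Let P x t := Du (w^~ t) x.
Let Q x t := D2u (w^~ t) x.

(** Convexity along the line through x says that 0 is a minimum of
    h |-> w(x + h v) + w(x - h v). *)
Lemma cgf_psd x t v : 0 <= t -> 0 <= quad (Q x t) v.
Proof.
move=> t0.
pose g (h : R) := - (w (x + h *: v) t + w (x + h *: - v) t).
pose g' (h : R) := - (dot (P (x + h *: v) t) v + dot (P (x + h *: - v) t) (- v)).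
have QN : quad (Q x t) (- v) = quad (Q x t) v.
  by rewrite -scaleN1r quadZr sqrrN expr1n mul1r.
suff : - (quad (Q x t) v + quad (Q x t) (- v)) <= 0 by rewrite QN; lra.
apply: (@second_order_max _ g g').
- by near=> h; apply: has_derivN; apply: has_derivD; exact: cgf_gradient.
- by apply: has_derivN; apply: has_derivD; exact: cgf_hessian.
- near=> h; rewrite /g lerN2 !scale0r !addr0.
  have half : 0 <= (1 / 2 : R) <= 1 by apply/andP; split; lra.
  have := cgf_convex wF (x + h *: v) (x + h *: - v) t0 half.
  have -> : (1 / 2) *: (x + h *: v) + (1 - 1 / 2) *: (x + h *: - v) = x.
    by apply/rowP => i; rewrite !mxE; field.
  lra.
Unshelve. all: by end_near. Qed.

(** The speed of a convex graph is nonnegative. *)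
Lemma cgf_nondecreasing x t : 0 <= t -> w x 0 <= w x t.
Proof.
move=> t0.
have dw (s : R) : 0 <= s -> has_deriv (w x) s (mc_operator (P x s) (Q x s)).
  exact: cgf_equation.
apply: (@ger0_derive1_le_cc R (w x) 0 t); rewrite ?in_itv /= ?lexx ?t0 //.
- by move=> s; rewrite in_itv /= => /andP[/ltW/dw[]].
- move=> s; rewrite in_itv /= => /andP[/ltW s0 _].
  have [_] := dw s s0; rewrite derive1E => ->.
  by apply: mc_operator_ge0 => v; exact: cgf_psd.
- apply: derivable_within_continuous => s.
  by rewrite in_itv /= => /andP[/dw[]].
Qed.

Lemma cgf_continuous_comp (S : topologicalType) (a : S -> 'rV[R]_n)
    (b : S -> R) (s : S) :
  {for s, continuous a} -> {for s, continuous b} -> 0 <= b s ->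
  {for s, continuous (fun s => w (a s) (b s))}.
Proof.
move=> ca cb bs.
have : {for s, continuous ((fun z : 'rV[R]_n * R => w z.1 z.2) \o
    (fun s => (a s, b s)))}.
  apply: continuous_comp; last exact: cgf_continuous.
  exact: (@cvg_pair _ _ _ _ (nbhs (a s)) (nbhs (b s))).
exact.
Qed.

Lemma cgf_bounded_below : exists2 m, 0 <= m & forall x, - m <= w x 0.
Proof.
have [r wr] := cgf_proper wF 0.
have [r0|r0] := ltP r 0.
  by exists 0 => // x; rewrite oppr0 ltW // wr // (lt_le_trans r0).
have K0 : [set x : 'rV[R]_n | `|x| <= r] !=set0 by exists 0; rewrite /= normr0.
have cw : {within [set x : 'rV[R]_n | `|x| <= r], continuous (w^~ 0)}.
  apply: continuous_subspaceT => x.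
  apply: (@cgf_continuous_comp _ id (fun=> 0)).
  - by move=> B.
  - exact: cst_continuous.
  - exact: lexx.
have [c _ cmin] := compact_EVT_min K0 (@rV_ball_compact _ n r) cw.
exists `|w c 0| => // x; have [xr|/wr/ltW wx] := leP `|x| r.
  apply: le_trans (cmin x _); last by rewrite inE.
  by rewrite lerNl -normrN ler_norm.
by apply: le_trans wx; rewrite oppr_le0.
Qed.

Lemma cgf_bounded_on r : exists m, forall x, `|x| <= r -> w x 0 <= m.
Proof.
have [r0|r0] := ltP r 0.
  by exists 0 => // x; rewrite leNgt (lt_le_trans r0).
have K0 : [set x : 'rV[R]_n | `|x| <= r] !=set0 by exists 0; rewrite /= normr0.
have cw : {within [set x : 'rV[R]_n | `|x| <= r], continuous (w^~ 0)}.
  apply: continuous_subspaceT => x.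
  apply: (@cgf_continuous_comp _ id (fun=> 0)).
  - by move=> B.
  - exact: cst_continuous.
  - exact: lexx.
have [c _ cmax] := compact_EVT_max K0 (@rV_ball_compact _ n r) cw.
by exists (w c 0) => // x xr; apply: cmax; rewrite inE.
Qed.

Lemma norm2_le_dot x : `|x| ^+ 2 <= dot x x.
Proof.
rewrite -[leRHS]sqr_sqrtr ?dotvv_ge0 //.
by rewrite lerXn2r ?nnegrE ?normr_ge0 ?sqrtr_ge0 //; exact: norm_le_enorm.
Qed.

(** Traced against a(p), the metric I + p^T p gives the dimension: this is why
    |X|^2 + 2 n t solves the heat equation on a mean curvature flow. *)
Lemma mc_operator_id x : mc_operator x (1%:M + x^T *m x) = n%:R.
Proof.
rewrite /mc_operator linearD /= mxtrace1 quadDl quad1 quad_tens.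
have -> : \tr (x^T *m x) = dot x x.
  by rewrite mxtrace_mulC dotE /mxtrace big_ord1.
have := add1_dotvv_gt0 x => /gt_eqF/negbT d0.
by field.
Qed.

Lemma dot_continuous x :
  continuous (fun z : 'rV[R]_n * R => dot (z.1 - x) (z.1 - x)).
Proof.
rewrite /dot; apply: continuous_big => [|i _ z]; first exact: add_continuous.
have ci : {for z, continuous (fun z : 'rV[R]_n * R => (z.1 - x) 0 i)}.
  apply: (@continuous_comp _ _ _ (fun z : 'rV[R]_n * R => z.1 - x)
    (fun y : 'rV[R]_n => y 0 i)); last exact: coord_continuous.
  by apply: cvgB; [exact: cvg_fst | exact: cvg_cst].
exact: cvgM.
Qed.

(** The sphere of radius r about (x, b) lies above the initial graph; the sphere
    of radius sqrt (r^2 - 2 n t) stays disjoint from the moving graph, because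
    |X - (x, b)|^2 + 2 n t solves the heat equation on it. So the graph has not
    reached the centre (x, b) by time T. The constant 2 n + 1 instead of 2 n
    makes the maximum principle strict. *)
Lemma cgf_barrier x (b : R) r T t : 0 < r -> (2 * n%:R + 1) * T < r ^+ 2 ->
  (forall z, `|z - x| <= r -> w z 0 <= b - r) -> 0 <= t <= T -> w x t <= b.
Proof.
move=> r0 rT wb tT.
pose c : R := 2 * n%:R + 1.
have c0 : 0 < c by rewrite /c ltr_wpDl // mulr_ge0.
pose f (z : 'rV[R]_n * R) : R :=
  r ^+ 2 - dot (z.1 - x) (z.1 - x) - (w z.1 z.2 - b) ^+ 2 - c * z.2.
have f_le0 : forall z s, 0 <= s <= T -> f (z, s) <= 0.
  apply: (@parabolic_maximum _ _ [set z | `|z| <= r + `|x|]).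
  - exact: rV_ball_compact.
  - move=> z s _ /andP[s0 _].
    have cw : {for (z, s), continuous (fun z : 'rV[R]_n * R => w z.1 z.2)}.
      exact: cgf_continuous.
    apply: cvgB; last by apply: cvgM; [exact: cvg_cst | exact: cvg_snd].
    apply: cvgB.
      by apply: cvgB; [exact: cvg_cst | exact: dot_continuous].
    by apply: cvgM; (apply: cvgB; [exact: cw | exact: cvg_cst]).
  - move=> z s /= /negP; rewrite -ltNge => zr /andP[s0 _].
    have : r <= `|z - x|.
      have := ler_normD (z - x) x; rewrite subrK; move: zr; lra.
    have := norm2_le_dot (z - x).
    rewrite /f /= => + H.
    have : r ^+ 2 <= `|z - x| ^+ 2 by rewrite lerXn2r ?nnegrE ?normr_ge0 ?(ltW r0).
    have := mulr_ge0 (ltW c0) s0.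
    have := sqr_ge0 (w z s - b); lra.
  - move=> z; rewrite /f /= mulr0 subr0.
    have [zr|zr] := leP `|z - x| r.
      have := wb z zr; have := dotvv_ge0 (z - x).
      set W := w z 0; nra.
    have := norm2_le_dot (z - x).
    have : r ^+ 2 <= `|z - x| ^+ 2 by rewrite lerXn2r ?nnegrE ?normr_ge0 ?(ltW r0) // ltW.
    have := sqr_ge0 (w z 0 - b); lra.
  - move=> z s /andP[s0 sT] zmax smax; have s0' := ltW s0.
    (* Half the Hessian of |X - (x, b)|^2 in graph coordinates. *)
    pose B := 1%:M + (P z s)^T *m P z s + (w z s - b) *: Q z s.
    have B0 v : 0 <= quad B v.
      rewrite /B !quadDl quadZl quad1 quad_tens.
      pose g (h : R) := f (z + h *: v, s).
      pose g' (h : R) := - (2 * dot (z - x) v + 2 * (h * dot v v)) -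
         2 * ((w (z + h *: v) s - b) * dot (P (z + h *: v) s) v).
      have gE : g = (fun h : R => (r ^+ 2 - c * s - dot (z - x) (z - x)) +
           (- (2 * (h * dot (z - x) v) + h * h * dot v v)
            - (w (z + h *: v) s - b) * (w (z + h *: v) s - b))).
        apply/funext => h; rewrite /g /f /=.
        have -> : z + h *: v - x = (z - x) + h *: v by rewrite addrAC.
        move: (z - x) => e.
        rewrite dotDl !dotDr !dotZl !dotZr. rewrite (dotC v e); ring.
      have dW h : has_deriv (fun h : R => w (z + h *: v) s - b) h (dot (P (z + h *: v) s) v).
        apply: has_deriv_eq (addr0 _).
        by apply: has_derivD; [exact: cgf_gradient | exact: has_deriv_cst].
      suff H : - (2 * (1 * dot v v)) - 2 *
          ((w z s - b) * quad (Q z s) v + dot (P z s) v * dot (P z s) v) <= 0.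
        by move: H; lra.
      apply: (@second_order_max _ g g').
      - near=> h; rewrite gE; apply: has_deriv_eq.
          apply: has_derivD; first exact: has_deriv_cst.
          apply: has_derivD.
            apply: has_derivN; apply: has_derivD.
              apply: has_derivZ.
              by apply: has_derivM; [exact: has_deriv_id|exact: has_deriv_cst].
            apply: has_derivM; last exact: has_deriv_cst.
            by apply: has_derivM; exact: has_deriv_id.
          by apply: has_derivN; apply: has_derivM; exact: dW.
        by rewrite /g'; ring.
      - apply: has_deriv_eq.
          apply: has_derivD.
            apply: has_derivN; apply: has_derivD; first exact: has_deriv_cst.
            by apply: has_derivZ; apply: has_derivM; [exact: has_deriv_id|exact: has_deriv_cst].
          apply: has_derivN; apply: has_derivZ; apply: has_derivM; first exact: dW.
          exact: cgf_hessian.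
        by rewrite !scale0r !addr0; ring.
      - by near=> h; rewrite /g scale0r addr0; exact: zmax.
    have := mc_operator_ge0 (P z s) B0.
    rewrite /B mc_operatorD mc_operator_id mc_operatorZ => mB.
    have df : has_deriv (fun s => f (z, s)) s
        (- (2 * ((w z s - b) * mc_operator (P z s) (Q z s))) - c).
      have dW : has_deriv (fun s => w z s - b) s (mc_operator (P z s) (Q z s)).
        apply: has_deriv_eq (addr0 _).
        apply: has_derivD; last exact: has_deriv_cst.
        by apply: cgf_equation => //; exact: ltW.
      have -> : (fun s => f (z, s)) = (fun s => (r ^+ 2 - dot (z - x) (z - x)) +
          (- ((w z s - b) * (w z s - b)) - c * s)).
        by apply/funext => s1; rewrite /f /=; ring.
      apply: has_deriv_eq.
        apply: has_derivD; first exact: has_deriv_cst.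
        apply: has_derivD; last by apply: has_derivN; apply: has_derivZ; exact: has_deriv_id.
        by apply: has_derivN; apply: has_derivM; exact: dW.
      by rewrite /=; ring.
    have := has_deriv_left_max s0 df smax; rewrite /c; lra.
case/andP: tT => t0 tT.
(* At z = x, the value w = b would give f > 0. *)
have wx s : 0 <= s <= t -> w x s != b.
  move=> /andP[s0 st]; apply/eqP => wxb.
  have := f_le0 x s; rewrite s0 (le_trans st tT) => /(_ isT).
  rewrite /f /= wxb !subrr expr0n /= /dot big1 => [|i _]; last by rewrite mxE mul0r.
  have : c * s <= c * T by rewrite ler_pM2l // (le_trans st).
  by rewrite /c in rT *; lra.
rewrite leNgt; apply/negP => bw.
have cw : {within `[0, t], continuous (w x)}.
  apply: derivable_within_continuous => s.
  by rewrite in_itv /= => /andP[s0 _]; case: (cgf_equation wF x s0).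
have w0 : w x 0 <= b.
  by have := wb x; rewrite subrr normr0 => /(_ (ltW r0)); move: r0; lra.
have [|s] := @IVT _ (w x) 0 t b t0 cw.
  by rewrite ge_min w0 le_max (ltW bw) orbT.
by rewrite in_itv /= => /wx/eqP.
Unshelve. all: by end_near. Qed.

(** The ball of radius r about k x is k x + (1 - k) B with B a fixed ball about 0,
    so convexity bounds w(., 0) on it by k w(x, 0) plus a constant; the barrier
    propagates this bound to later times. *)
Lemma cgf_growth (k T : R) : 0 < k < 1 -> 0 <= T ->
  exists C, forall x t, 0 <= t <= T -> w (k *: x) t <= k * w x 0 + C.
Proof.
move=> /andP[k0 k1] T0.
have n0 : 0 <= n%:R :> R by [].
pose r := (2 * n%:R + 1) * T + 1.
have rT : 0 <= (2 * n%:R + 1) * T by rewrite mulr_ge0 //; lra.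
have r0 : 0 < r by rewrite /r; lra.
have rr : (2 * n%:R + 1) * T < r ^+ 2 by rewrite /r; nra.
have [m wm] := cgf_bounded_on (r / (1 - k)).
exists ((1 - k) * m + r) => x t tT.
apply: (cgf_barrier r0 rr _ tT) => z zr.
have k1' : 0 < 1 - k by rewrite subr_gt0.
have zE : z = k *: x + (1 - k) *: ((1 - k)^-1 *: (z - k *: x)).
  by rewrite scalerA divff ?gt_eqF // scale1r addrC subrK.
have kk : 0 <= k <= 1 by rewrite !ltW.
have := cgf_convex wF x ((1 - k)^-1 *: (z - k *: x)) (lexx 0) kk.
rewrite -zE => /le_trans; apply.
have : w ((1 - k)^-1 *: (z - k *: x)) 0 <= m.
  by apply: wm; rewrite normrZ gtr0_norm ?invr_gt0 // mulrC ler_pM2r ?invr_gt0.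
move=> /(ler_wpM2l (ltW k1')); lra.
Qed.

(** The hypothesis on v0 and v1 collects the first and second variation at a
    maximum of w(k (x0 + x1) / 2) - w(x0) / 2 - w(x1) / 2. Variations of a
    single point identify the gradients; the simultaneous variation a v, b v
    moves the midpoint by v, as a + b = 2, and compares the Hessians with the
    weights k^2, a^2 / 2 and b^2 / 2 that appear in the time derivatives. *)
Lemma touching_speeds (a b k e : R) (p0 p1 ph : 'rV[R]_n) (A0 A1 Ah : 'M[R]_n) :
  a + b = 2 -> 0 < k < 1 -> 0 < e -> (forall v, 0 <= quad Ah v) ->
  (forall v0 v1 (v := (k * 2^-1) *: (v0 + v1)),
    dot ph v - 2^-1 * dot p0 v0 - 2^-1 * dot p1 v1 = 0 /\
    quad Ah v - 2^-1 * quad A0 v0 - 2^-1 * quad A1 v1 <= 0) ->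
  k ^+ 2 * mc_operator ph Ah - 2^-1 * (a ^+ 2 * mc_operator p0 A0)
    - 2^-1 * (b ^+ 2 * mc_operator p1 A1) - e < 0.
Proof.
move=> ab /andP[k0 k1] e0 Ah0 variation.
have dot0 v : dot v 0 = 0 by rewrite -(scale0r (0 : 'rV[R]_n)) dotZr mul0r.
have p0E : p0 = k *: ph.
  apply/rowP => i; have [+ _] := variation (delta_mx 0 i) 0.
  rewrite addr0 dotZr dot0 !dot_delta mxE; lra.
have p1E : p1 = k *: ph.
  apply/rowP => i; have [+ _] := variation 0 (delta_mx 0 i).
  rewrite add0r dotZr dot0 !dot_delta mxE; lra.
pose B := (2^-1 * a ^+ 2) *: A0 + (2^-1 * b ^+ 2) *: A1 - k ^+ 2 *: Ah.
have B0 v : 0 <= quad B v.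
  have [_] := variation (a *: v) (b *: v).
  rewrite -scalerDl ab scalerA divfK // !quadZr /B !quadDl quadNl !quadZl; lra.
have k01 : 0 <= k <= 1 by rewrite !ltW.
have := mc_operator_ge0 (k *: ph) B0.
rewrite /B !mc_operatorD mc_operatorN !mc_operatorZ p0E p1E.
have := ler_wpM2l (exprn_ge0 2 (ltW k0)) (mc_operator_scale ph Ah0 k01); lra.
Qed.

(** The constant c is independent of k, so that the error (1 - k) c, which
    absorbs the effect of the dilation at time 0, vanishes as k tends to 1. *)
Lemma cgf_comparison (a b : R) : 0 < a -> 0 < b -> a + b = 2 ->
  exists c : R, forall k e T : R, 0 < k < 1 -> 0 < e -> 0 <= T ->
  forall x0 x1 t, 0 <= t <= T ->
  w (k *: (2^-1 *: (x0 + x1))) (k ^+ 2 * t) <=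
    2^-1 * w x0 (a ^+ 2 * t) + 2^-1 * w x1 (b ^+ 2 * t) + e * t + (1 - k) * c.
Proof.
move=> a0 b0 ab; have [m m0 wm] := cgf_bounded_below.
exists (w 0 0 + m) => k e T k01 e0 T0; case/andP: (k01) => k0 k1.
set c := (1 - k) * (w 0 0 + m).
have c0 : 0 <= c by rewrite mulr_ge0 ?subr_ge0 ?(ltW k1) //; have := wm 0; lra.
have a20 : 0 < a ^+ 2 by rewrite exprn_gt0.
have b20 : 0 < b ^+ 2 by rewrite exprn_gt0.
have k20 : 0 < k ^+ 2 by rewrite exprn_gt0.
pose mid (z : 'rV[R]_n * 'rV[R]_n) := k *: (2^-1 *: (z.1 + z.2)).
pose f (z : ('rV[R]_n * 'rV[R]_n) * R) : R :=
  w (mid z.1) (k ^+ 2 * z.2) - 2^-1 * w z.1.1 (a ^+ 2 * z.2)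
  - 2^-1 * w z.1.2 (b ^+ 2 * z.2) - e * z.2 - c.
suff f_le0 : forall (z : 'rV[R]_n * 'rV[R]_n) t, 0 <= t <= T -> f (z, t) <= 0.
  move=> x0 x1 t tT; have := f_le0 (x0, x1) t tT; rewrite /f /mid /=; lra.
have [C wC] := cgf_growth k01 (mulr_ge0 (ltW k20) T0).
(* Where one of w(x0, 0), w(x1, 0) exceeds this level, the other is at least - m,
   and the gain (1 - k) (w(x0, 0) + w(x1, 0)) / 2 of the dilation beats C. *)
have [r wr] := cgf_proper wF (m + 2 * `|C| / (1 - k)).
have mid0 (z : 'rV[R]_n * 'rV[R]_n) :
    w (2^-1 *: (z.1 + z.2)) 0 <= 2^-1 * w z.1 0 + 2^-1 * w z.2 0.
  have half : 0 <= (2^-1 : R) <= 1 by apply/andP; split; lra.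
  have := cgf_convex wF z.1 z.2 (lexx 0) half.
  have -> : 1 - 2^-1 = 2^-1 :> R by lra.
  by rewrite scalerDr.
apply: (@parabolic_maximum _ _
  ([set x : 'rV[R]_n | `|x| <= r] `*` [set x : 'rV[R]_n | `|x| <= r])).
- by apply: compact_setX; exact: rV_ball_compact.
- move=> z t _ /andP[t0 _].
  have cz (d : R) : 0 <= d -> {for (z, t), continuous
      (fun z : ('rV[R]_n * 'rV[R]_n) * R => d * z.2)}.
    by move=> d0; apply: cvgM; [exact: cvg_cst | exact: cvg_snd].
  have c1 : {for (z, t), continuous (fun z : ('rV[R]_n * 'rV[R]_n) * R => z.1.1)}.
    apply: (@continuous_comp _ _ _ (fun z : ('rV[R]_n * 'rV[R]_n) * R => z.1)
      (fun z : ('rV[R]_n * 'rV[R]_n) => z.1)); exact: cvg_fst.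
  have c2 : {for (z, t), continuous (fun z : ('rV[R]_n * 'rV[R]_n) * R => z.1.2)}.
    apply: (@continuous_comp _ _ _ (fun z : ('rV[R]_n * 'rV[R]_n) * R => z.1)
      (fun z : ('rV[R]_n * 'rV[R]_n) => z.2)); [exact: cvg_fst|exact: cvg_snd].
  have cmid : {for (z, t), continuous (fun z : ('rV[R]_n * 'rV[R]_n) * R => mid z.1)}.
    by apply: cvgZr; apply: cvgZr; exact: cvgD.
  have w_cont (A : ('rV[R]_n * 'rV[R]_n) * R -> 'rV[R]_n) (d : R) : 0 <= d ->
      {for (z, t), continuous A} -> {for (z, t), continuous
      (fun z : ('rV[R]_n * 'rV[R]_n) * R => w (A z) (d * z.2))}.
    move=> d0 cA; apply: cgf_continuous_comp => //=; [exact: cz|exact: mulr_ge0].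
  apply: cvgB; last exact: cvg_cst.
  apply: cvgB; last by apply: cz; exact: ltW.
  apply: cvgB.
    apply: cvgB; first by apply: w_cont => //; exact: ltW.
    apply: cvgM; first exact: cvg_cst.
    by apply: w_cont => //; exact: ltW.
  apply: cvgM; first exact: cvg_cst.
  by apply: w_cont => //; exact: ltW.
- move=> z t zr /andP[t0 tT].
  have k2t : 0 <= k ^+ 2 * t <= k ^+ 2 * T.
    by rewrite mulr_ge0 ?(ltW k20) // ler_pM2l.
  have := wC (2^-1 *: (z.1 + z.2)) _ k2t.
  have := mid0 z.
  have := cgf_nondecreasing z.1 (mulr_ge0 (ltW a20) t0).
  have := cgf_nondecreasing z.2 (mulr_ge0 (ltW b20) t0).
  have := mulr_ge0 (ltW e0) t0.
  have k1' : 0 < 1 - k by rewrite subr_gt0.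
  suff : 2 * `|C| <= (1 - k) * (w z.1 0 + w z.2 0).
    rewrite /f /mid /= => H1 H2 H3 H4 H5 H6.
    have := ler_wpM2l (ltW k0) H5; have := ler_norm C; nra.
  rewrite -ler_pdivrMl // mulrC.
  have := wm z.1; have := wm z.2.
  have [z1r|/wr z1r] := leP `|z.1| r; last by move: z1r; lra.
  by have [z2r|/wr z2r] := leP `|z.2| r; [case: zr | move: z2r; lra].
- move=> z; rewrite /f /mid /= !mulr0 subr0.
  have k01' : 0 <= k <= 1 by rewrite !ltW.
  have := cgf_convex wF (2^-1 *: (z.1 + z.2)) 0 (lexx 0) k01'.
  rewrite scaler0 addr0 /c.
  have := mid0 z => /(ler_wpM2l (ltW k0)).
  have := wm z.1; have := wm z.2; nra.
- move=> [x0 x1] t /andP[t0 tT] zmax tmax.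
  set y := k *: (2^-1 *: (x0 + x1)).
  have pos d : 0 < d -> 0 <= d * t by move=> d0; rewrite mulr_ge0 ?ltW.
  have [tk ta tb] := And3 (pos _ k20) (pos _ a20) (pos _ b20).
  set ph := P y (k ^+ 2 * t); set Ah := Q y (k ^+ 2 * t).
  set p0 := P x0 (a ^+ 2 * t); set A0 := Q x0 (a ^+ 2 * t).
  set p1 := P x1 (b ^+ 2 * t); set A1 := Q x1 (b ^+ 2 * t).
  have variation v0 v1 (v := (k * 2^-1) *: (v0 + v1)) :
      dot ph v - 2^-1 * dot p0 v0 - 2^-1 * dot p1 v1 = 0 /\
      quad Ah v - 2^-1 * quad A0 v0 - 2^-1 * quad A1 v1 <= 0.
    pose g (h : R) := f ((x0 + h *: v0, x1 + h *: v1), t).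
    pose g' (h : R) := dot (P (y + h *: v) (k ^+ 2 * t)) v
      - 2^-1 * dot (P (x0 + h *: v0) (a ^+ 2 * t)) v0
      - 2^-1 * dot (P (x1 + h *: v1) (b ^+ 2 * t)) v1.
    have gE : g = (fun h : R => w (y + h *: v) (k ^+ 2 * t)
      - 2^-1 * w (x0 + h *: v0) (a ^+ 2 * t)
      - 2^-1 * w (x1 + h *: v1) (b ^+ 2 * t) + (- (e * t) - c)).
      apply/funext => h; rewrite /g /f /mid /=.
      have -> : k *: (2^-1 *: (x0 + h *: v0 + (x1 + h *: v1))) = y + h *: v.
        by apply/rowP => i; rewrite !mxE; ring.
      by ring.
    have dg h : has_deriv g h (g' h).
      rewrite gE; apply: has_deriv_eq (addr0 _); apply: has_derivD; last exact: has_deriv_cst.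
      apply: has_derivD; last by apply: has_derivN; apply: has_derivZ; exact: cgf_gradient.
      apply: has_derivD; first exact: cgf_gradient.
      by apply: has_derivN; apply: has_derivZ; exact: cgf_gradient.
    have gmax : \forall h \near (0 : R), g h <= g 0.
      by near=> h; rewrite /g !scale0r !addr0; exact: zmax.
    have g'0 : g' 0 = dot ph v - 2^-1 * dot p0 v0 - 2^-1 * dot p1 v1.
      by rewrite /g' !scale0r !addr0.
    rewrite -g'0; split; first exact: has_deriv_local_max gmax.
    apply: (@second_order_max _ g g') => //; first by near=> h.
    apply: has_derivD; last by apply: has_derivN; apply: has_derivZ; exact: cgf_hessian.
    apply: has_derivD; first exact: cgf_hessian.
    by apply: has_derivN; apply: has_derivZ; exact: cgf_hessian.
  have df : has_deriv (fun s => f ((x0, x1), s)) t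
      (k ^+ 2 * mc_operator ph Ah - 2^-1 * (a ^+ 2 * mc_operator p0 A0)
       - 2^-1 * (b ^+ 2 * mc_operator p1 A1) - e).
    have -> : (fun s => f ((x0, x1), s)) = (fun s : R => w y (k ^+ 2 * s)
      - 2^-1 * w x0 (a ^+ 2 * s) - 2^-1 * w x1 (b ^+ 2 * s) - e * s + - c).
      by [].
    apply: has_deriv_eq (addr0 _); apply: has_derivD; last exact: has_deriv_cst.
    apply: has_derivD; last first.
      apply: has_deriv_eq; first by apply: has_derivN; apply: has_derivZ; exact: has_deriv_id.
      by rewrite mulr1.
    apply: has_derivD; last first.
      by apply: has_derivN; apply: has_derivZ; apply: has_deriv_rescale; exact: cgf_equation.
    apply: has_derivD; first by apply: has_deriv_rescale; exact: cgf_equation.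
    by apply: has_derivN; apply: has_derivZ; apply: has_deriv_rescale; exact: cgf_equation.
  have Ah0 v : 0 <= quad Ah v by exact: cgf_psd.
  have := has_deriv_left_max t0 df tmax.
  by apply/negP; rewrite -ltNge; exact: touching_speeds.
Unshelve. all: by end_near. Qed.

Lemma cgf_midpoint (a b : R) x0 x1 t : 0 < a -> 0 < b -> a + b = 2 -> 0 <= t ->
  w (2^-1 *: (x0 + x1)) t <= 2^-1 * w x0 (a ^+ 2 * t) + 2^-1 * w x1 (b ^+ 2 * t).
Proof.
move=> a0 b0 ab t0; have [c wc] := cgf_comparison a0 b0 ab.
set S := (X in _ <= X); set y := _ *: _.
have wk (k : R) : 0 < k < 1 -> w (k *: y) (k ^+ 2 * t) - (1 - k) * c <= S.
  move=> k01; apply/ler_addgt0Pr => e e0.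
  have t1 : 0 < t + 1 by rewrite ltr_wpDl.
  have := wc k (e / (t + 1)) t k01 (divr_gt0 e0 t1) t0 x0 x1 t.
  rewrite t0 lexx => /(_ isT); rewrite -/S -/y.
  have : e / (t + 1) * t <= e.
    by rewrite mulrAC ler_pdivrMr // ler_pM2l // lerDl.
  by rewrite /S; lra.
pose phi (k : R) := w (k *: y) (k ^+ 2 * t) - (1 - k) * c.
have -> : w y t = phi 1 by rewrite /phi scale1r expr1n mul1r subrr mul0r subr0.
apply: (@le_continuous_left _ phi 1 S 1) => //.
- apply: cvgB.
    apply: (@cgf_continuous_comp _ (fun k : R => k *: y) (fun k : R => k ^+ 2 * t)).
    + by apply: cvgZl; exact: cvg_id.
    + by apply: cvgM; [apply: cvgM; exact: cvg_id | exact: cvg_cst].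
    + by rewrite expr1n mul1r.
  by apply: cvgM; [apply: cvgB; [exact: cvg_cst|exact: cvg_id] | exact: cvg_cst].
- by move=> k; rewrite subrr => /wk.
Qed.

End ConvexGraphFlow.

(** * Symmetry of second derivatives *)

Section MixedDerivatives.
Variables (R : realType) (V : normedModType R).
Implicit Types (x v w : V) (f : V -> R).

Lemma has_deriv_line f x v (h : R) : differentiable f (x + h *: v) ->
  has_deriv (fun h : R => f (x + h *: v)) h ('D_v f (x + h *: v)).
Proof.
move=> df; apply: (@is_derive_curve _ _ _ f (fun h : R => x + h *: v)) => //.
exact: is_derive_affine.
Qed.

Lemma nbhs_parallelogram (x v w : V) (B : set V) : nbhs x B ->
  exists2 e : R, 0 < e & forall s r : R, `|s| < e -> `|r| < e ->
    B (x + s *: v + r *: w).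
Proof.
move=> /nbhs_ballP[d /= d0 dB].
have N0 : 0 < `|v| + `|w| + 1 by rewrite ltr_wpDl // addr_ge0.
exists (d / (`|v| + `|w| + 1)); first by rewrite divr_gt0.
move=> s r; rewrite !ltr_pdivlMr // => sd rd; apply: dB.
rewrite -ball_normE /ball_ /= -addrA opprD addNKr normrN.
apply: (le_lt_trans (ler_normD _ _)); rewrite !normrZ.
have := normr_ge0 s; have := normr_ge0 r; have := normr_ge0 v.
have := normr_ge0 w; move: sd rd; set a := `|s|; set b := `|r|.
set c := `|v|; set e := `|w|.
move=> sd rd e0 c0 b0 a0.
have [ab|/ltW ba] := leP a b.
  have := ler_wpM2r c0 ab; have := mulr_ge0 b0 c0; lra.
have := ler_wpM2r e0 ba; have := mulr_ge0 a0 e0; lra.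
Qed.

(** Two applications of the mean value theorem, first in the direction v, then
    in the direction w. *)
Lemma second_difference (A : set V) f x v w (h : R) : 0 < h ->
  (forall s r : R, 0 <= s <= h -> 0 <= r <= h -> A (x + s *: v + r *: w)) ->
  (forall y, A y -> differentiable f y /\ differentiable ('D_v f) y) ->
  exists s r : R, [/\ 0 < s < h, 0 < r < h &
    f (x + h *: v + h *: w) - f (x + h *: v) - (f (x + h *: w) - f x) =
    'D_w ('D_v f) (x + s *: v + r *: w) * h * h].
Proof.
move=> h0 Ah df.
have hh : 0 <= h <= h by rewrite lexx ltW.
have h00 : 0 <= (0 : R) <= h by rewrite lexx ltW.
have A0 (s : R) : 0 <= s <= h -> A (x + s *: v).
  by move=> /Ah/(_ h00); rewrite scale0r addr0.
pose G (s : R) := f (x + h *: w + s *: v) + - f (x + s *: v).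
pose G' (s : R) := 'D_v f (x + h *: w + s *: v) + - 'D_v f (x + s *: v).
have dG s : 0 <= s <= h -> has_deriv G s (G' s).
  move=> sh; apply: has_derivD; last apply: has_derivN; apply: has_deriv_line.
    by rewrite addrAC; exact: (df _ (Ah _ _ sh hh)).1.
  exact: (df _ (A0 _ sh)).1.
have itvoo (s : R) : s \in `]0, h[ -> 0 <= s <= h.
  by rewrite in_itv /= => /andP[s0 sh]; rewrite !ltW.
have cG : {within `[0, h], continuous G}.
  by apply: derivable_within_continuous => s; rewrite in_itv /= => /dG[].
have [s /[dup] sI /itvoo sh Gh] := MVT h0 (fun s sI => dG s (itvoo s sI)) cG.
pose K (r : R) := 'D_v f (x + s *: v + r *: w).
pose K' (r : R) := 'D_w ('D_v f) (x + s *: v + r *: w).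
have dK r : 0 <= r <= h -> has_deriv K r (K' r).
  by move=> rh; apply: has_deriv_line; exact: (df _ (Ah _ _ sh rh)).2.
have cK : {within `[0, h], continuous K}.
  by apply: derivable_within_continuous => r; rewrite in_itv /= => /dK[].
have [r rI Kh] := MVT h0 (fun r rI => dK r (itvoo r rI)) cK.
exists s, r; split; first by move: sI; rewrite in_itv.
  by move: rI; rewrite in_itv.
move: Kh Gh; rewrite !subr0 /K /K' /G /G' !scale0r !addr0 => Kh.
by rewrite [x + h *: w + s *: v]addrAC Kh [x + h *: w + h *: v]addrAC.
Qed.

(** The same second difference is computed in both orders, so each mixed
    derivative at a point near x equals the other one at another such point;
    both are continuous. *)
Lemma derive_comm (A : set V) f x v w : open A -> smooth_on A f -> A x ->
  'D_v ('D_w f) x = 'D_w ('D_v f) x.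
Proof.
move=> oA sf Ax.
have d0 y : A y -> differentiable f y by exact: (sf [::]).
have d1 u y : A y -> differentiable ('D_u f) y by exact: (sf [:: u]).
have d2 u u' y : A y -> differentiable ('D_u ('D_u' f)) y.
  exact: (sf [:: u; u']).
apply/eqP; rewrite -subr_eq0 -normr_le0; apply/ler_addgt0Pr => e e0.
rewrite add0r.
have e20 : 0 < e / 2 by rewrite divr_gt0.
have tri (p q y : R) : `|p - y| < e / 2 -> `|q - y| < e / 2 -> `|q - p| <= e.
  rewrite distrC => py qy.
  by rewrite (le_trans (ler_distD y q p)) // (splitr e) ltW // ltrD.
have near_D u u' : nbhs x [set y | `|'D_u ('D_u' f) x - 'D_u ('D_u' f) y| < e / 2].
  have := differentiable_continuous (d2 u u' x Ax).
  by move=> /cvgrPdist_lt/(_ _ e20).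
have [k k0 kB] := nbhs_parallelogram v w (filterI (open_nbhs_nbhs (conj oA Ax))
  (filterI (near_D v w) (near_D w v))).
pose h := k / 2.
have h0 : 0 < h by rewrite divr_gt0.
have hk : h < k by rewrite /h; lra.
have inB s r : 0 <= s <= h -> 0 <= r <= h ->
    (A `&` ([set y | `|'D_v ('D_w f) x - 'D_v ('D_w f) y| < e / 2] `&`
     [set y | `|'D_w ('D_v f) x - 'D_w ('D_v f) y| < e / 2]))
    (x + s *: v + r *: w).
  move=> /andP[s0 sh] /andP[r0 rh]; apply: kB.
    by rewrite ger0_norm // (le_lt_trans sh).
  by rewrite ger0_norm // (le_lt_trans rh).
have lt_le (s : R) : 0 < s < h -> 0 <= s <= h by move=> /andP[? ?]; rewrite !ltW.
have [|y Ay|s [r [/lt_le sh /lt_le rh E1]]] := @second_difference A f x v w h h0.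
- by move=> s r sh rh; have [] := inB s r sh rh.
- by split; [exact: d0|exact: d1].
have [|y Ay|r' [s' [/lt_le rh' /lt_le sh' E2]]] := @second_difference A f x w v h h0.
- by move=> s' r' sh' rh'; rewrite addrAC; have [] := inB r' s' rh' sh'.
- by split; [exact: d0|exact: d1].
have [_ [_ N1]] := inB s r sh rh.
have [_ [N2 _]] := inB s' r' sh' rh'.
rewrite /= addrAC in N2.
have E : 'D_w ('D_v f) (x + s *: v + r *: w) = 'D_v ('D_w f) (x + r' *: w + s' *: v).
  apply: (mulIf (lt0r_neq0 h0)); apply: (mulIf (lt0r_neq0 h0)).
  have swap (p q o l : R) : p - q - (o - l) = p - o - (q - l) by ring.
  rewrite [x + h *: w + h *: v]addrAC in E2.
  exact: etrans (esym E1) (etrans (swap _ _ _ _) E2).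
move: N1; rewrite /= E => N1.
exact: (tri _ _ _ N1 N2).
Qed.

End MixedDerivatives.

(** * Derivatives of the height function in space-time *)

Section SpacetimeCalculus.
Variables (R : realType) (n : nat) (u : 'rV[R]_n -> R -> R).
Hypothesis su : smooth_graph_function u.
Implicit Types (x v : 'rV[R]_n) (t : R) (z : 'rV[R]_n * R).

Let U z : R := u z.1 z.2.
Let Om : set ('rV[R]_n * R) := [set z | 0 < z.2].
Let e i : 'rV[R]_n * R := (delta_mx 0 i, 0).
Let tau : 'rV[R]_n * R := (0, 1).

Definition time_derivative x t : R :=
  'D_((0 : 'rV[R]_n, 1 : R)) (fun z : 'rV[R]_n * R => u z.1 z.2) (x, t).

Definition time_derivative2 x t : R :=
  'D_((0 : 'rV[R]_n, 1 : R)) (fun z => time_derivative z.1 z.2) (x, t).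

Lemma open_positive_time : open Om.
Proof.
have -> : Om = snd @^-1` [set t : R | 0 < t] by [].
by apply: open_comp; [move=> z _; exact: cvg_snd | exact: open_gt].
Qed.

(** Spatial derivatives at a fixed time are space-time derivatives in
    horizontal directions; no differentiability is involved. *)
Lemma derive_slice (G : 'rV[R]_n * R -> R) v x t :
  'D_v (fun x => G (x, t)) x = 'D_((v, 0 : R)) G (x, t).
Proof.
rewrite /derive; set f1 := fun h : R => _; set f2 := fun h : R => _.
suff -> : f1 = f2 by [].
apply/funext => h; rewrite /f1 /f2 /=.
have -> : h *: (v, 0 : R) + (x, t) = (h *: v + x, h *: (0 : R) + t) by [].
by rewrite scaler0 add0r.
Qed.

Lemma partialE x t i : partial (u^~ t) i x = 'D_(e i) U (x, t).
Proof. exact: (derive_slice U). Qed.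

Lemma DuE x t i : Du (u^~ t) x 0 i = 'D_(e i) U (x, t).
Proof. by rewrite mxE partialE. Qed.

Lemma D2uE x t i j : D2u (u^~ t) x i j = 'D_(e i) ('D_(e j) U) (x, t).
Proof.
rewrite mxE {1}/partial; have -> : partial (u^~ t) j = fun x => 'D_(e j) U (x, t).
  by apply/funext => y; exact: partialE.
exact: derive_slice.
Qed.

Lemma differentiable_height x t : 0 < t -> differentiable U (x, t).
Proof. exact: (@su [::] (x, t)). Qed.

Lemma differentiable_height_derive (d : 'rV[R]_n * R) x t :
  0 < t -> differentiable ('D_d U) (x, t).
Proof. exact: (@su [:: d] (x, t)). Qed.

Lemma derive_decomp (f : 'rV[R]_n * R -> R) z v (s : R) : differentiable f z ->
  'D_((v, s)) f z = \sum_i v 0 i * 'D_(e i) f z + s * 'D_tau f z.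
Proof.
move=> df; rewrite !deriveE //.
have -> : (v, s) = \sum_i v 0 i *: e i + s *: tau.
  have -> : \sum_i v 0 i *: e i = (v, 0).
    rewrite [in RHS](row_sum_delta v); elim/big_rec2: _ => [//|i y1 y2 _ ->].
    have -> : v 0 i *: e i + (y1, 0 : R) =
      (v 0 i *: delta_mx 0 i + y1, v 0 i *: (0 : R) + 0) by [].
    by rewrite scaler0 addr0.
  have -> : (v, 0 : R) + s *: tau = (v + s *: 0, 0 + s *: (1 : R)) by [].
  by rewrite scaler0 addr0 add0r [s *: 1]mulr1.
rewrite linearD linear_sum /= linearZ /=; congr (_ + _).
by apply: eq_bigr => i _; rewrite linearZ /= deriveE.
Qed.

Lemma D2u_sym x t : 0 < t -> (D2u (u^~ t) x)^T = D2u (u^~ t) x.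
Proof.
move=> t0; apply/matrixP => i j; rewrite mxE !D2uE.
exact: (derive_comm _ _ open_positive_time su).
Qed.

Definition time_derivative_gradient x t : 'rV[R]_n :=
  \row_i 'D_(delta_mx 0 i, 0 : R) (fun z => time_derivative z.1 z.2) (x, t).

Let UtE : (fun z => time_derivative z.1 z.2) = 'D_tau U.
Proof. by apply/funext => -[]. Qed.

Section Curve.
Variables (a : R -> 'rV[R]_n) (b : R -> R) (h : R) (v : 'rV[R]_n) (s : R).
Hypotheses (da : is_derive h (1 : R) a v) (db : has_deriv b h s) (b0 : 0 < b h).

Lemma is_derive_pair : is_derive h (1 : R) (fun h => (a h, b h)) (v, s).
Proof.
case: da db => [a1 a2] [b1 b2].
have a3 : differentiable a h by apply/derivable1_diffP.
have b3 : differentiable b h by apply/derivable1_diffP.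
apply: DeriveDef; first exact/diff_derivable/differentiable_pair.
rewrite deriveE; last exact: differentiable_pair.
by rewrite diff_pair // -!deriveE // a2 b2.
Qed.

(** The chain rules for u, u_t and Du along a curve (a, b) in space-time with
    velocity (v, s) are instances of this one. *)
Lemma has_deriv_curve (f : 'rV[R]_n * R -> R) : differentiable f (a h, b h) ->
  has_deriv (fun h => f (a h, b h)) h
    (\sum_i v 0 i * 'D_(e i) f (a h, b h) + s * 'D_tau f (a h, b h)).
Proof.
move=> df; rewrite -derive_decomp //.
exact: (is_derive_curve (c := fun h => (a h, b h)) df is_derive_pair).
Qed.

Lemma graph_curve : has_deriv (fun h => u (a h) (b h)) h
  (dot (Du (u^~ (b h)) (a h)) v + s * time_derivative (a h) (b h)).
Proof.
apply: has_deriv_eq; first exact: (has_deriv_curve (differentiable_height _ b0)).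
by congr (_ + _); apply: eq_bigr => i _; rewrite DuE mulrC.
Qed.

Lemma time_derivative_curve :
  has_deriv (fun h => time_derivative (a h) (b h)) h
    (dot (time_derivative_gradient (a h) (b h)) v
     + s * time_derivative2 (a h) (b h)).
Proof.
apply: has_deriv_eq; first exact: (has_deriv_curve (differentiable_height_derive tau _ b0)).
by rewrite /time_derivative2 UtE; congr (_ + _); apply: eq_bigr => i _;
  rewrite mxE UtE mulrC.
Qed.

Lemma Du_curve j : has_deriv (fun h => Du (u^~ (b h)) (a h) 0 j) h
  ((v *m D2u (u^~ (b h)) (a h) + s *: time_derivative_gradient (a h) (b h)) 0 j).
Proof.
have -> : (fun h => Du (u^~ (b h)) (a h) 0 j) = (fun h => 'D_(e j) U (a h, b h)).
  by apply/funext => r; exact: DuE.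
apply: has_deriv_eq; first exact: (has_deriv_curve (differentiable_height_derive (e j) _ b0)).
have -> : (v *m D2u (u^~ (b h)) (a h)
    + s *: time_derivative_gradient (a h) (b h)) 0 j =
    \sum_i v 0 i * D2u (u^~ (b h)) (a h) i j
    + s * time_derivative_gradient (a h) (b h) 0 j.
  by rewrite mxE; congr (_ + _); rewrite mxE.
have -> : time_derivative_gradient (a h) (b h) 0 j = 'D_tau ('D_(e j) U) (a h, b h).
  rewrite mxE UtE.
  exact: (derive_comm (e j) tau open_positive_time su).
by congr (_ + _); apply: eq_bigr => i _; rewrite D2uE.
Qed.

End Curve.

End SpacetimeCalculus.

Section Dot.
Variables (R : realType) (n : nat).

Lemma has_deriv_dot (A B : R -> 'rV[R]_n) (h : R) (A' B' : 'rV[R]_n) :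
  (forall j, has_deriv (fun h => A h 0 j) h (A' 0 j)) ->
  (forall j, has_deriv (fun h => B h 0 j) h (B' 0 j)) ->
  has_deriv (fun h => dot (A h) (B h)) h (dot (A h) B' + dot (B h) A').
Proof.
move=> dA dB; rewrite /dot -big_split /=.
have -> : (fun h => \sum_i A h 0 i * B h 0 i) = \sum_i (fun h => A h 0 i * B h 0 i).
  by apply/funext => r; rewrite fct_sumE.
by apply: is_derive_sum => i; exact: has_derivM.
Qed.

End Dot.

(** * Geometry of a graph *)

Section GraphGeometryFacts.
Variables (R : realType) (n : nat).
Implicit Types (f phi : 'rV[R]_n -> R) (x v p : 'rV[R]_n).

Lemma area_element_gt0 f x : 0 < area_element f x.
Proof. by rewrite sqrtr_gt0 add1_dotvv_gt0. Qed.

Lemma area_element_sqr f x : area_element f x ^+ 2 = 1 + dot (Du f x) (Du f x).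
Proof. by rewrite sqr_sqrtr // ltW // add1_dotvv_gt0. Qed.

Lemma tens_mul p : (p^T *m p) *m (p^T *m p) = dot p p *: (p^T *m p).
Proof.
rewrite mulmxA -(mulmxA p^T p) [p *m p^T]mx11_scalar -dotE.
by rewrite mul_mx_scalar scalemxAl.
Qed.

Lemma metric_mx_inverse f x (p := Du f x) :
  metric_mx f x *m (1%:M - (1 + dot p p)^-1 *: (p^T *m p)) = 1%:M.
Proof.
have /gt_eqF/negbT s0 := add1_dotvv_gt0 p.
rewrite /metric_mx -/p mulmxBr mulmx1 -scalemxAr mulmxDl mul1mx tens_mul.
rewrite -[X in _ *: (X + _)]scale1r -scalerDl scalerA mulVf // scale1r.
by rewrite addrK.
Qed.

Lemma metric_mx_unit f x : metric_mx f x \in unitmx.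
Proof. by have [] := mulmx1_unit (metric_mx_inverse f x). Qed.

(** The Sherman-Morrison formula for a rank one perturbation of the identity. *)
Lemma invmx_metric f x (p := Du f x) :
  invmx (metric_mx f x) = 1%:M - (1 + dot p p)^-1 *: (p^T *m p).
Proof.
by rewrite -[RHS](mulKmx (metric_mx_unit f x)) metric_mx_inverse mulmx1.
Qed.

Lemma mean_curvatureE f x : mean_curvature f x =
  mc_operator (Du f x) (D2u f x) / area_element f x.
Proof.
rewrite /mean_curvature invmx_metric /sff_mx -scalemxAr linearZ /= mulrC.
congr (_ / _); rewrite /mc_operator mulmxBl mul1mx linearB /=; congr (_ - _).
rewrite -scalemxAl linearZ /= mulrC; congr (_ / _).
by rewrite -mulmxA mxtrace_mulC /mxtrace big_ord1.
Qed.

Lemma dot_graph_tangent f x v w :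
  dot (graph_tangent f x v) (graph_tangent f x w) =
  (v *m metric_mx f x *m w^T) 0 0.
Proof.
have mxED (X Y : 'M[R]_1) : (X + Y) 0 0 = X 0 0 + Y 0 0 by rewrite mxE.
have -> : (v *m metric_mx f x *m w^T) 0 0 =
    dot v w + dot (Du f x) v * dot (Du f x) w.
  rewrite /metric_mx mulmxDr mulmx1 mulmxDl mxED -dotE; congr (_ + _).
  by rewrite mulmxA -mulmxA mxE big_ord1 -!dotE (dotC v).
rewrite {1}/dot big_split_ord /= big_ord1 !row_mxEr !mxE eqxx !mulr1n.
by congr (_ + _); apply: eq_bigr => i _; rewrite !row_mxEl.
Qed.

Lemma dot_graph_grad f phi x v :
  dot (graph_grad f phi x) (graph_tangent f x v) = dot (Du phi x) v.
Proof.
rewrite /graph_grad dot_graph_tangent mulmxKV ?metric_mx_unit //.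
by rewrite dotE.
Qed.

Lemma sff_graph_tangent f x v :
  sff f x (graph_tangent f x v) (graph_tangent f x v) =
  quad (D2u f x) v / area_element f x.
Proof. by rewrite /sff !row_mxKl -[LHS]/(quad _ _) quadZl mulrC. Qed.

End GraphGeometryFacts.

(** * The scalar evolution equation *)

Section GraphFlowEquation.
Variables (R : realType) (n : nat) (M : Type) (A : set (chart R n M)).
Variables (F : M -> R -> 'rV[R]_(n + 1)) (u : 'rV[R]_n -> R -> R).
Hypotheses (su : smooth_graph_function u) (flow : graph_mean_curvature_flow A F u).

Lemma flow_graph_pt p t : 0 < t -> F p t = graph_pt (u^~ t) (base_pt F p t).
Proof.
move=> t0; have : range (F^~ t) (F p t) by exists p.
by rewrite (flow_graph flow t0) => -[x _ Fx]; rewrite /base_pt -Fx row_mxKl.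
Qed.

(** Every point of the graph at time t is occupied by some point of M, so that
    identities along trajectories hold at all (x, t). *)
Lemma flow_base_pt_surj x t : 0 < t -> exists p, base_pt F p t = x.
Proof.
move=> t0; have : graph (u^~ t) (graph_pt (u^~ t) x) by exists x.
by rewrite -(flow_graph flow t0) => -[p _ Fx]; exists p; rewrite /base_pt Fx row_mxKl.
Qed.

(** The motion being along the normal, the base point slides down the gradient. *)
Lemma is_derive_base_pt p t (x := base_pt F p t) : 0 < t ->
  is_derive t (1 : R) (base_pt F p)
    (- (curvature_at F u p t / area_element (u^~ t) x) *: Du (u^~ t) x).
Proof.
move=> t0; have dF := flow_eq flow p t0.
have := is_derive_curve (differentiable_lsubmx (F p t)) dF.
rewrite deriveE; last exact: differentiable_lsubmx.
rewrite diff_lin; last exact: continuous_lsubmx.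
by rewrite linearZ /= /upward_normal linearZ /= row_mxKl scalerA scalerN -scaleNr.
Qed.

Lemma has_deriv_height p t (x := base_pt F p t) : 0 < t ->
  has_deriv (fun t => rsubmx (F p t) 0 0) t
    (curvature_at F u p t / area_element (u^~ t) x).
Proof.
move=> t0; have dF := flow_eq flow p t0.
have := is_derive_curve (differentiable_rsubmx (F p t)) dF.
rewrite deriveE; last exact: differentiable_rsubmx.
rewrite diff_lin; last exact: continuous_rsubmx.
rewrite linearZ /= /upward_normal linearZ /= row_mxKr scalerA => -[dr].
rewrite derive_mx // => /matrixP/(_ 0 0); rewrite !mxE eqxx mulr1 => Er.
apply: DeriveDef; last exact: Er.
by move/derivable_mxP: dr; exact.
Qed.

(** Differentiate the relation height = u(base point, t) along the trajectory
    through (x, u(x, t)). *)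
Lemma time_derivativeE x t : 0 < t ->
  time_derivative u x t = mc_operator (Du (u^~ t) x) (D2u (u^~ t) x).
Proof.
move=> t0; have [p px] := flow_base_pt_surj x t0.
pose k := curvature_at F u p t / area_element (u^~ t) x.
have dh : has_deriv (fun t => rsubmx (F p t) 0 0) t k.
  by rewrite /k -px; exact: has_deriv_height.
have db : is_derive t (1 : R) (base_pt F p) (- k *: Du (u^~ t) x).
  by rewrite /k -px; exact: is_derive_base_pt.
have du := graph_curve su db (has_deriv_id t) t0.
have hu : \forall s \near t, rsubmx (F p s) 0 0 = u (base_pt F p s) s.
  near=> s; have s0 : 0 < s by near: s; exact: lt_nbhsr.
  by rewrite (flow_graph_pt p s0) row_mxKr mxE eqxx mulr1n.
have [_ E1] := near_eq_is_derive hu dh; have [_ E2] := du.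
move: E1; rewrite E2 px mul1r dotZr => E.
have W0 := area_element_gt0 (u^~ t) x.
have W2 := area_element_sqr (u^~ t) x.
have kE : k * area_element (u^~ t) x ^+ 2 = mc_operator (Du (u^~ t) x) (D2u (u^~ t) x).
  rewrite /k /curvature_at px mean_curvatureE; field.
  by rewrite gt_eqF.
rewrite -kE W2; move: E; set d := dot _ _; lra.
Unshelve. all: by end_near. Qed.

End GraphFlowEquation.

(** * The Harnack inequality *)

Section Harnack.
Variables (R : realType) (n : nat) (M : Type) (A : set (chart R n M)).
Variables (F : M -> R -> 'rV[R]_(n + 1)) (u : 'rV[R]_n -> R -> R).
Hypotheses (su : smooth_graph_function u) (flow : graph_mean_curvature_flow A F u).
Hypothesis ucvx : forall t, 0 < t -> convex_function [set: 'rV[R]_n] (u^~ t).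
Hypothesis uprop : forall t, 0 < t -> proper_entire (u^~ t).

Lemma delayed_flow (s : R) : 0 < s -> convex_graph_flow (fun x t => u x (s + t)).
Proof.
move=> s0; have st t : 0 <= t -> 0 < s + t by move=> t0; rewrite ltr_wpDr.
split.
- move=> x t t0.
  have c : {for (x, t), continuous (fun z : 'rV[R]_n * R => (z.1, s + z.2))}.
    apply: (@cvg_pair _ _ _ _ (nbhs x) (nbhs (s + t))); first exact: cvg_fst.
    by apply: cvgD; [exact: cvg_cst | exact: cvg_snd].
  have := differentiable_continuous (differentiable_height su x (st t t0)).
  exact: (continuous_comp c).
- move=> x v t h t0; apply: has_deriv_eq.
    exact: (graph_curve su (is_derive_affine x v h) (has_deriv_cst h (s + t)) (st t t0)).
  by rewrite mul0r addr0.
- move=> x v t t0; rewrite /quad -dotE dotC.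
  have dA j : has_deriv (fun h => Du (u^~ (s + t)) (x + h *: v) 0 j) 0
      ((v *m D2u (u^~ (s + t)) x) 0 j).
    apply: has_deriv_eq.
      exact: (Du_curve su (is_derive_affine x v 0) (has_deriv_cst 0 (s + t)) (st t t0)).
    by rewrite scale0r addr0 scale0r addr0.
  have dB j : has_deriv (fun h : R => v 0 j) 0 ((0 : 'rV[R]_n) 0 j).
    by rewrite mxE; exact: has_deriv_cst.
  apply: has_deriv_eq; first exact: (has_deriv_dot (B := fun=> v) dA dB).
  by rewrite -(scale0r (0 : 'rV[R]_n)) dotZr mul0r add0r.
- move=> x t t0.
  have dx : is_derive t (1 : R) (fun=> x) 0 by exact: is_derive_cst.
  have ds : has_deriv (fun t => s + t) t 1.
    by apply: has_deriv_eq (add0r _); apply: has_derivD; [exact: has_deriv_cst | exact: has_deriv_id].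
  apply: has_deriv_eq; first exact: (graph_curve su dx ds (st t t0)).
  rewrite -(scale0r (0 : 'rV[R]_n)) dotZr mul0r add0r mul1r.
  by rewrite (time_derivativeE su flow) // st.
- move=> x y t k t0 /andP[k0 k1].
  exact: (ucvx (st t t0) (Itv01 k0 k1) (mem_set I) (mem_set I)).
- move=> a; rewrite addr0; have [r ur] := uprop s0 a.
  by exists r => x xr; apply: ur; apply: lt_le_trans xr (norm_le_enorm x).
Qed.

Let Ut x t := time_derivative u x t.
Let Utt x t := time_derivative2 u x t.
Let K x t := time_derivative_gradient u x t.

(** The midpoint inequality with a, b = 1 -+ h / (2 T), for the flow started at
    time t - T, compares t with the times t -+ h + h^2 / (4 T): it says that
    u(x + h v, t + h + h^2 / (4 T)) is midpoint convex at h = 0. The term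
    u_t / (2 T) is the contribution of the acceleration of this curve. *)
Lemma delayed_harnack_quadratic x v t (T : R) : 0 < T < t ->
  0 <= Utt x t + 2 * dot (K x t) v + quad (D2u (u^~ t) x) v + Ut x t / (2 * T).
Proof.
move=> /andP[T0 Tt].
have t0 : 0 < t by exact: lt_trans Tt.
have s0 : 0 < t - T by rewrite subr_gt0.
have mid := cgf_midpoint (delayed_flow s0).
pose b (h : R) := t + h + (4 * T)^-1 * (h * h).
pose b' (h : R) := 1 + (2 * T)^-1 * h.
have db h : has_deriv b h (b' h).
  apply: has_deriv_eq.
    apply: has_derivD; last by apply: has_derivZ; apply: has_derivM; exact: has_deriv_id.
    by apply: has_derivD; [exact: has_deriv_cst | exact: has_deriv_id].
  by rewrite /b'; field; rewrite gt_eqF.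
have db' h : has_deriv b' h (2 * T)^-1.
  apply: has_deriv_eq.
    by apply: has_derivD; [exact: has_deriv_cst | apply: has_derivZ; exact: has_deriv_id].
  by rewrite add0r mulr1.
pose g (h : R) := u (x + h *: v) (b h).
pose g' (h : R) := dot (Du (u^~ (b h)) (x + h *: v)) v + b' h * Ut (x + h *: v) (b h).
have dg h : 0 < b h -> has_deriv g h (g' h).
  exact: (graph_curve su (is_derive_affine x v h) (db h)).
have b0 : b 0 = t by rewrite /b; ring.
have b'0 : b' 0 = 1 by rewrite /b'; ring.
have g2 : has_deriv g' 0 (dot (v *m D2u (u^~ t) x + K x t) v +
    (dot (K x t) v + Utt x t + (2 * T)^-1 * Ut x t)).
  have bt : 0 < b 0 by rewrite b0.
  have dx := is_derive_affine x v 0.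
  have x0 : x + 0 *: v = x by rewrite scale0r addr0.
  have dA j : has_deriv (fun h => Du (u^~ (b h)) (x + h *: v) 0 j) 0
      ((v *m D2u (u^~ t) x + K x t) 0 j).
    apply: has_deriv_eq; first exact: (Du_curve su dx (db 0) bt).
    by rewrite /= x0 b0 b'0 scale1r.
  have dB j : has_deriv (fun h : R => v 0 j) 0 ((0 : 'rV[R]_n) 0 j).
    by rewrite mxE; exact: has_deriv_cst.
  apply: has_deriv_eq.
    apply: has_derivD; first exact: (has_deriv_dot (B := fun=> v) dA dB).
    by apply: has_derivM; [exact: db' | exact: (time_derivative_curve su dx (db 0) bt)].
  rewrite /= x0 b0 b'0 -(scale0r (0 : 'rV[R]_n)) dotZr mul0r add0r !mul1r.
  by rewrite (dotC v) [_ * (2 * T)^-1]mulrC.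
(* Midpoint convexity bounds g 0 by the mean of g h and g (- h) only, so the
   second order condition is applied to their sum. *)
pose k (h : R) := - (g h + g (-1 * h)).
pose k' (h : R) := - (g' h + -1 * g' (-1 * h)).
have bpos : \forall h \near (0 : R), 0 < b h.
  have cb : {for 0, continuous b}.
    by apply: differentiable_continuous; apply/derivable1_diffP; case: (db 0).
  by apply: (cvgr_gt (b 0) cb); rewrite b0.
have bposN : \forall h \near (0 : R), 0 < b (-1 * h).
  have cN : {for 0, continuous (fun h : R => -1 * h)}.
    by apply: cvgM; [exact: cvg_cst | exact: cvg_id].
  have cb : {for (-1 * 0), continuous b}.
    by apply: differentiable_continuous; apply/derivable1_diffP; case: (db (-1 * 0)).
  have cbN : {for 0, continuous (b \o (fun h : R => -1 * h))}.
    exact: continuous_comp.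
  by apply: (cvgr_gt (b (-1 * 0)) cbN); rewrite mulr0 b0.
have kmax : \forall h \near (0 : R), k h <= k 0.
  have T20 : 0 < 2 * T by rewrite mulr_gt0.
  near=> h.
  have hT : `|h| < 2 * T.
    by near: h; apply: (@nbhs0_lt _ R^o).
  have [h1 h2] : h < 2 * T /\ - (2 * T) < h.
    by move: hT; rewrite ltr_norml => /andP[].
  pose al := 1 - (2 * T)^-1 * h; pose be := 1 + (2 * T)^-1 * h.
  have ih1 : (2 * T)^-1 * h < 1 by rewrite mulrC ltr_pdivrMr // mul1r.
  have ih2 : -1 < (2 * T)^-1 * h by rewrite mulrC ltr_pdivlMr // mulN1r.
  have al0 : 0 < al by rewrite /al; lra.
  have be0 : 0 < be by rewrite /be; lra.
  have ab : al + be = 2 by rewrite /al /be; lra.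
  have := mid al be (x + (-1 * h) *: v) (x + h *: v) T al0 be0 ab (ltW T0).
  have -> : 2^-1 *: (x + (-1 * h) *: v + (x + h *: v)) = x.
    by apply/rowP => i; rewrite !mxE; field.
  have Tn0 : T != 0 by rewrite gt_eqF.
  have -> : t - T + T = t by ring.
  have -> : t - T + al ^+ 2 * T = b (-1 * h) by rewrite /al /b; field.
  have -> : t - T + be ^+ 2 * T = b h by rewrite /be /b; field.
  rewrite /k /g mulr0 b0 scale0r addr0; lra.
have k2 := second_order_max _ _ kmax.
have : - (dot (v *m D2u (u^~ t) x + K x t) v +
    (dot (K x t) v + Utt x t + (2 * T)^-1 * Ut x t) +
    -1 * (-1 * (dot (v *m D2u (u^~ t) x + K x t) v +
      (dot (K x t) v + Utt x t + (2 * T)^-1 * Ut x t)))) <= 0.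
  apply: (k2 k').
    near=> h; apply: has_derivN; apply: has_derivD; first by apply: dg; near: h.
    by apply: has_deriv_rescale; apply: dg; near: h.
  apply: has_derivN; apply: has_derivD; first exact: g2.
  by apply: has_derivZ; apply: has_deriv_rescale; rewrite mulr0; exact: g2.
rewrite dotDl /quad -dotE mulrC (mulrC (Ut x t)); lra.
Unshelve. all: by end_near. Qed.

(** Multiplied by 2 T, the delayed inequality is affine in T and extends to T = t. *)
Lemma harnack_quadratic x v t : 0 < t ->
  0 <= Utt x t + 2 * dot (K x t) v + quad (D2u (u^~ t) x) v + Ut x t / (2 * t).
Proof.
move=> t0; set C := _ + quad _ _.
pose phi (T : R) := - (2 * T * C + Ut x t).
have phi0 : phi t <= 0.
  apply: (@le_continuous_left _ phi t 0 t t0).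
    apply: cvgN; apply: cvgD; last exact: cvg_cst.
    apply: cvgM; last exact: cvg_cst.
    by apply: cvgM; [exact: cvg_cst | exact: cvg_id].
  move=> T; rewrite subrr => /andP[T0 Tt].
  have := delayed_harnack_quadratic x v (introT andP (conj T0 Tt)).
  have T20 : 0 < 2 * T by rewrite mulr_gt0.
  rewrite -/C => /(mulr_ge0 (ltW T20)).
  by rewrite mulrDr (mulrC _ (Ut x t / _)) divfK ?gt_eqF // /phi oppr_le0.
have t20 : 0 < 2 * t by rewrite mulr_gt0.
rewrite -(pmulr_rge0 _ t20) mulrDr (mulrC _ (Ut x t / _)) divfK ?gt_eqF //.
by rewrite -oppr_le0.
Qed.

Lemma derive_line (f : 'rV[R]_n -> R) x v (d : R) :
  has_deriv (fun h => f (x + h *: v)) 0 d -> 'D_v f x = d.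
Proof.
move=> [_ <-]; apply: (congr1 (fun g : R -> R => lim (g @ 0^'))).
apply/funext => h /=.
by rewrite scale0r !addr0 [h *: 1]mulr1 (addrC x).
Qed.

Lemma has_deriv_invsqrt (S : R -> R) (h s : R) : 0 < S h -> has_deriv S h s ->
  has_deriv (fun h => (Num.sqrt (S h))^-1) h (- s / (2 * Num.sqrt (S h) ^+ 3)).
Proof.
move=> S0 dS; have q0 : Num.sqrt (S h) != 0 by rewrite gt_eqF // sqrtr_gt0.
have [dq qE] := is_derive1_sqrt S0.
have dq' : differentiable Num.sqrt (S h) by apply/derivable1_diffP.
have [d1 d2] := is_derive_curve dq' dS.
apply: DeriveDef; first exact: (derivableV (f := Num.sqrt \o S)).
rewrite (deriveV (f := Num.sqrt \o S)) // d2 /=.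
have -> : 'D_s Num.sqrt (S h) = s * (2 * Num.sqrt (S h))^-1.
  rewrite -qE !deriveE // -[in LHS](mulr1 s); exact: linearZ.
rewrite /GRing.scale /=; move: q0; move: (Num.sqrt (S h)) => q q0; field.
exact: q0.
Qed.

(** H = u_t / sqrt (1 + |Du|^2) for the flow, so H is differentiated without
    third derivatives of u. *)
Lemma mean_curvature_curve (a : R -> 'rV[R]_n) (b : R -> R) (h : R)
    (v : 'rV[R]_n) (s : R) (x := a h) (t := b h) (W := area_element (u^~ t) x)
    (p := Du (u^~ t) x) :
  is_derive h (1 : R) a v -> has_deriv b h s -> 0 < b h ->
  has_deriv (fun h => mean_curvature (u^~ (b h)) (a h)) h
    ((dot (K x t) v + s * Utt x t) / W -
     Ut x t * (dot (p *m D2u (u^~ t) x) v + s * dot (K x t) p) / W ^+ 3).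
Proof.
move=> da db b0.
pose S (h : R) := 1 + dot (Du (u^~ (b h)) (a h)) (Du (u^~ (b h)) (a h)).
have bnear : \forall r \near h, 0 < b r.
  have cb : {for h, continuous b}.
    by apply: differentiable_continuous; apply/derivable1_diffP; case: db.
  exact: (cvgr_gt (b h) cb).
have mcE : \forall r \near h, Ut (a r) (b r) * (Num.sqrt (S r))^-1 =
    mean_curvature (u^~ (b r)) (a r).
  near=> r; have br : 0 < b r by near: r.
  by rewrite mean_curvatureE /Ut (time_derivativeE su flow _ br).
apply: (near_eq_is_derive mcE).
have dp := Du_curve su da db b0.
have dS : has_deriv S h
    (2 * (dot (p *m D2u (u^~ t) x) v + s * dot (K x t) p)).
  apply: has_deriv_eq; first by apply: has_derivD; [exact: has_deriv_cst | exact: (has_deriv_dot dp dp)].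
  rewrite add0r -/x -/t -/p dotDr dotZr (dotC p (time_derivative_gradient _ _ _)).
  rewrite -/(K x t); have -> : dot p (v *m D2u (u^~ t) x) = dot (p *m D2u (u^~ t) x) v.
    by rewrite !dotE trmx_mul (D2u_sym su) // mulmxA.
  ring.
apply: has_deriv_eq.
  apply: has_derivM; first exact: (time_derivative_curve su da db b0).
  by apply: has_deriv_invsqrt dS; exact: add1_dotvv_gt0.
rewrite /= -/x -/t -![Num.sqrt (S h)]/W -/(K x t) -/(Ut x t) -/(Utt x t).
have : W != 0 by rewrite gt_eqF // area_element_gt0.
move: W => W W0.
move: (dot _ v) (dot _ v) (dot _ p) (Ut _ _) (Utt _ _) => d1 d2 d3 d4 d5.
by field.
Unshelve. all: by end_near. Qed.

Lemma Du_mean_curvature x t (W := area_element (u^~ t) x) (p := Du (u^~ t) x) :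
  0 < t -> Du (mean_curvature (u^~ t)) x =
  W^-1 *: K x t - (Ut x t / W ^+ 3) *: (p *m D2u (u^~ t) x).
Proof.
move=> t0; apply/rowP => i.
have := mean_curvature_curve (is_derive_affine x (delta_mx 0 i) 0) (has_deriv_cst 0 t) t0.
rewrite /= scale0r addr0 !mul0r !addr0 !dot_delta -/W -/p => /derive_line D.
have -> : Du (mean_curvature (u^~ t)) x 0 i = 'D_(delta_mx 0 i) (mean_curvature (u^~ t)) x.
  by rewrite mxE.
rewrite {}D; move: (K x t) (p *m D2u _ _) (Ut x t) => k q d.
by rewrite !mxE; ring.
Qed.

End Harnack.

Theorem corollary5p3 (R : realType) (n : nat) (M : Type)
  (A : set (chart R n M)) (F : M -> R -> 'rV[R]_(n + 1))
  (u : 'rV[R]_n -> R -> R) :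
  smooth_manifold A ->
  smooth_graph_function u ->
  graph_mean_curvature_flow A F u ->
  (forall t : R, 0 < t -> convex_function [set: 'rV[R]_n] (u^~ t)) ->
  (forall t : R, 0 < t -> proper_entire (u^~ t)) ->
  forall t : R, 0 < t ->
  forall V : 'rV[R]_(n + 1) -> 'rV[R]_(n + 1), tangent_field (u^~ t) V ->
  forall p : M,
    0 <= derive1 (curvature_at F u p) t
         + 2 * dot (graph_grad (u^~ t) (mean_curvature (u^~ t)) (base_pt F p t))
                   (V (F p t))
         + sff (u^~ t) (base_pt F p t) (V (F p t)) (V (F p t))
         + curvature_at F u p t / (2 * t).
Proof.
move=> _ su flow ucvx uprop t t0 V tV p.
set x := base_pt F p t.
have [v Vv] := tV x.
rewrite (flow_graph_pt flow p t0) -/x Vv dot_graph_grad sff_graph_tangent.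
rewrite (Du_mean_curvature su flow x t0).
have dH := mean_curvature_curve su flow (is_derive_base_pt flow p t0)
  (has_deriv_id t) t0.
rewrite derive1E; case: dH => _; rewrite -[X in 'D_1 X t]/(curvature_at F u p) => ->.
rewrite /curvature_at -/x mean_curvatureE -(time_derivativeE su flow x t0).
set W := area_element (u^~ t) x; set P := Du (u^~ t) x.
set Q := D2u (u^~ t) x.
have W0 : W != 0 by rewrite gt_eqF // area_element_gt0.
have WW : 0 < W by exact: area_element_gt0.
have QT : Q^T = Q by exact: (D2u_sym su).
(* The vector v - c P is the eta of the introduction. *)
pose c := time_derivative u x t / W ^+ 2.
have := harnack_quadratic su flow ucvx uprop x (v - c *: P) t0; rewrite -/Q.
move: (time_derivative_gradient u x t) => K.
rewrite (quad_subZ _ _ _ QT) dotDr dotNr dotZr.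
have Wi0 : 0 <= W^-1 by rewrite invr_ge0 ltW.
move=> harnack; apply: (le_trans (mulr_ge0 harnack Wi0)).
rewrite le_eqVlt; apply/orP; left; apply/eqP.
rewrite !dotZr dotDl dotNl !dotZl /c {c harnack}.
move: (dot K v) (dot K P) (dot (P *m Q) v) (dot (P *m Q) P) (quad Q v).
move: (time_derivative u x t) (time_derivative2 u x t) W W0 {WW Wi0}.
move=> ut utt W W0 kv kp qv qp vv.
have tn0 : t != 0 by rewrite gt_eqF.
by field; rewrite tn0 W0.
Qed.
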